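(* Let $\boldsymbol{\rho}=(\rho_1,\dots,\rho_m)$ and $\boldsymbol{\tau}=(\tau_1,\dots,\tau_n)$ be two contraction vectors such that $\mathcal{D}(\boldsymbol{\rho})\sim\mathcal{D}(\boldsymbol{\tau})$, and let $\boldsymbol{\lambda}=(\lambda_1,\dots,\lambda_s)$ be a common pseudo-basis of $\boldsymbol{\rho}$ and $\boldsymbol{\tau}$. Put $$X_j=\log_{\boldsymbol{\lambda}}\rho_j\ (1\le j\le m),\qquad Y_k=\log_{\boldsymbol{\lambda}}\tau_k\ (1\le k\le n),$$ and $X=\{X_1,\dots,X_m\}$, $Y=\{Y_1,\dots,Y_n\}$. Then: (i) $\mathbf{C}_X=\mathbf{C}_Y$; (ii) $\gamma_X(\theta)=\gamma_Y(\theta)$ for every unit vector $\theta\in\mathbf{C}_X$.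
   Context: Lipschitz equivalence. Fix $d\ge1$. Subsets $E,F\subset\mathbb{R}^d$ are Lipschitz equivalent, $E\sim F$, if there are a bijection $f:E\to F$ and a constant $C>0$ with $C^{-1}|x-y|\le|f(x)-f(y)|\le C|x-y|$ for all $x,y\in E$. Dust-like sets. For an iterated function system $\{\phi_j\}_{j=1}^m$ of contractive similarities of $\mathbb{R}^d$ with ratios $\rho_j\in(0,1)$, the attractor is the unique nonempty compact set $E$ with $E=\bigcup_{j=1}^m\phi_j(E)$; it is dust-like if the sets $\phi_1(E),\dots,\phi_m(E)$ are pairwise disjoint. A contraction vector is $\boldsymbol{\rho}=(\rho_1,\dots,\rho_m)$ with all $\rho_j\in(0,1)$ and $\sum_{j=1}^m\rho_j^d<1$. $\mathcal{D}(\boldsymbol{\rho})$ is the set of all dust-like self-similar sets in $\mathbb{R}^d$ with contraction ratios $\rho_1,\dots,\rho_m$. It is well known that all elements of $\mathcal{D}(\boldsymbol{\rho})$ are Lipschitz equivalent to each other; $\mathcal{D}(\boldsymbol{\rho})\sim\mathcal{D}(\boldsymbol{\tau})$ means that $E\sim F$ for some (and thus for all) $E\in\mathcal{D}(\boldsymbol{\rho})$, $F\in\mathcal{D}(\boldsymbol{\tau})$. Pseudo-basis. $\langle\boldsymbol{\rho}\rangle=\langle\rho_1,\dots,\rho_m\rangle$ is the subgroup of the multiplicative group of positive reals generated by $\rho_1,\dots,\rho_m$; its rank is the cardinality of a basis of this free abelian group. Positive reals $\lambda_1,\dots,\lambda_s$ form a pseudo-basis of $\boldsymbol{\rho}$ if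 $\langle\boldsymbol{\rho}\rangle\subset\langle\lambda_1,\dots,\lambda_s\rangle$ and $\operatorname{rank}\langle\boldsymbol{\rho}\rangle=s$. A common pseudo-basis of $\boldsymbol{\rho}$ and $\boldsymbol{\tau}$ is one which is a pseudo-basis of both. Then $x=(x_1,\dots,x_s)\mapsto\boldsymbol{\lambda}^x=\prod_{i=1}^s\lambda_i^{x_i}$ is an isomorphism $\mathbb{Z}^s\to\langle\boldsymbol{\lambda}\rangle$, and $\log_{\boldsymbol{\lambda}}:\langle\boldsymbol{\lambda}\rangle\to\mathbb{Z}^s$ denotes its inverse. Cone, multiplicity and directional growth function. Let $X=\{X_1,\dots,X_m\}$ be a finite family (repetitions allowed, counted with index) of vectors of $\mathbb{Z}^s$ spanning $\mathbb{R}^s$ and contained in an open half-space, i.e. $X_j\cdot\boldsymbol{\alpha}>0$ for all $j$ for some $\boldsymbol{\alpha}\in\mathbb{R}^s$. (For $X_j=\log_{\boldsymbol{\lambda}}\rho_j$ one may take $\boldsymbol{\alpha}=-(\log\lambda_1,\dots,\log\lambda_s)$, as $X_j\cdot\boldsymbol{\alpha}=-\log\rho_j>0$.) With $\mathbb{R}^+$ the non-negative reals and $\mathbb{N}=\{0,1,2,\dots\}$, put $$\mathbf{C}_X=\mathbb{R}^+X_1+\cdots+\mathbb{R}^+X_m,\qquad \mathcal{J}=X_1\mathbb{N}+\cdots+X_m\mathbb{N}.$$ Let $\Sigma_m^*=\bigcup_{k\ge0}\{1,\dots,m\}^k$ be the set of finite words and $\kappa(i_1\dots i_k)=X_{i_1}+\cdots+X_{i_k}$.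 For $z\in\mathcal{J}$ the multiplicity is $\mathbf{m}(z)=\#\{\omega\in\Sigma_m^*:\kappa(\omega)=z\}$. For $x\in\mathbf{C}_X\setminus\mathcal{J}$, $$\mathbf{m}(x)=\min\{\mathbf{m}(z):\ z\in\mathcal{J},\ |x-z|=d(x,\mathcal{J})\},\qquad d(x,\mathcal{J})=\min\{|x-z|:z\in\mathcal{J}\},$$ with $|\cdot|$ the Euclidean norm. For a unit vector $\theta\in\mathbf{C}_X$ the directional growth function is $$\gamma_X(\theta)=\lim_{k\to\infty}\frac{\log\mathbf{m}(k\theta)}{k};$$ it is known (Fan, Rao and Zhang) that this limit always exists. $\mathbf{C}_Y$ and $\gamma_Y$ are defined in the same way from $Y=\{Y_1,\dots,Y_n\}$. *)

(* Defs.v *)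
From HB Require Import structures.
From mathcomp Require Import all_boot all_order all_algebra.
From mathcomp Require Import finmap.
From mathcomp Require Import all_classical all_reals all_analysis.

Set Implicit Arguments.
Unset Strict Implicit.
Unset Printing Implicit Defensive.

Import Order.TTheory GRing.Theory Num.Theory.
Import numFieldNormedType.Exports.

Local Open Scope classical_set_scope.
Local Open Scope ring_scope.

(* The minimum of a set that has one, and the junk value x0 otherwise. *)
Definition set_min (disp : Order.disp_t) (T : porderType disp) (x0 : T)
    (A : set T) : T :=
  xget x0 (A `&` lbound A).

(* The norm which the library puts on row vectors is the sup norm, hence this
   definition; the topology on row vectors is the same for both norms. *)
Definition enorm (R : realType) (d : nat) (x : 'rV[R]_d) : R :=
  Num.sqrt (\sum_(i < d) x ord0 i ^+ 2).

(* The bijection is given as a function on the whole space of which only the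
   values on E matter. *)
Definition lipschitz_equiv (R : realType) (d : nat) (E F : set 'rV[R]_d) : Prop :=
  exists (f : 'rV[R]_d -> 'rV[R]_d) (C : R),
    [/\ set_bij E F f, 0 < C &
      forall x y, E x -> E y ->
        C^-1 * enorm (x - y) <= enorm (f x - f y) <= C * enorm (x - y)].

Definition similarity (R : realType) (d : nat) (r : R)
    (phi : 'rV[R]_d -> 'rV[R]_d) : Prop :=
  forall x y, enorm (phi x - phi y) = r * enorm (x - y).

Definition attractor (R : realType) (d m : nat)
    (phi : 'I_m -> 'rV[R]_d -> 'rV[R]_d) (E : set 'rV[R]_d) : Prop :=
  [/\ E !=set0, compact E & E = \bigcup_j (phi j @` E)].

Definition contraction_vector (R : realType) (d m : nat) (rho : 'I_m -> R) : Prop :=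
  (forall j, 0 < rho j < 1) /\ \sum_(j < m) rho j ^+ d < 1.

Definition dust_like_sets (R : realType) (d m : nat) (rho : 'I_m -> R) :
    set (set 'rV[R]_d) :=
  [set E | exists phi : 'I_m -> 'rV[R]_d -> 'rV[R]_d,
    [/\ forall j, similarity (rho j) (phi j), attractor phi E &
        trivIset setT (fun j => phi j @` E)]].

Definition dust_like_equiv (R : realType) (d m n : nat)
    (rho : 'I_m -> R) (tau : 'I_n -> R) : Prop :=
  exists E F : set 'rV[R]_d,
    [/\ dust_like_sets rho E, dust_like_sets tau F & lipschitz_equiv E F].

Definition pos_subgroup (R : realType) (H : set R) : Prop :=
  [/\ forall x, H x -> 0 < x, H 1 & forall x y, H x -> H y -> H (x / y)].

Definition mgen (R : realType) (m : nat) (rho : 'I_m -> R) : set R :=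
  smallest (@pos_subgroup R) (range rho).

Definition lpow (R : realType) (s : nat) (lambda : 'I_s -> R) (x : 'rV[int]_s) : R :=
  \prod_(i < s) lambda i ^ x ord0 i.

Definition mbasis (R : realType) (s : nat) (G : set R) (b : 'I_s -> R) : Prop :=
  [/\ forall i, 0 < b i, mgen b = G & forall x, lpow b x = 1 -> x = 0].

Definition has_rank (R : realType) (G : set R) (s : nat) : Prop :=
  exists b : 'I_s -> R, mbasis G b.

Definition pseudo_basis (R : realType) (m s : nat) (rho : 'I_m -> R)
    (lambda : 'I_s -> R) : Prop :=
  [/\ forall i, 0 < lambda i, mgen rho `<=` mgen lambda & has_rank (mgen rho) s].

(* The inverse of lpow lambda, which is injective when lambda is a
   pseudo-basis; the junk value 0 outside the range of lpow lambda. *)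
Definition mlog (R : realType) (s : nat) (lambda : 'I_s -> R) (r : R) : 'rV[int]_s :=
  xget 0 [set x | lpow lambda x = r].

Section Directional_growth.
Variables (R : realType) (s m : nat) (X : 'I_m -> 'rV[int]_s).

Definition real_vec (z : 'rV[int]_s) : 'rV[R]_s := map_mx intr z.

Definition cone : set 'rV[R]_s :=
  [set x | exists2 t : 'I_m -> R, forall j, 0 <= t j &
           x = \sum_(j < m) t j *: real_vec (X j)].

Definition lattice_cone : set 'rV[R]_s :=
  [set x | exists k : 'I_m -> nat, x = \sum_(j < m) real_vec (X j) *+ k j].

Definition kappa (w : seq 'I_m) : 'rV[R]_s := \sum_(i <- w) real_vec (X i).

(* fset_set is the junk value fset0 on infinite sets; but only finitely many
   words have a given value when X lies in an open half-space. *)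
Definition word_mult (z : 'rV[R]_s) : nat :=
  #|` fset_set [set w : seq 'I_m | kappa w = z] |.

Definition dist_lattice (x : 'rV[R]_s) : R :=
  set_min 0 [set enorm (x - z) | z in lattice_cone].

Definition mult (x : 'rV[R]_s) : nat :=
  if `[< lattice_cone x >] then word_mult x
  else set_min 0%N [set word_mult z | z in
         [set z | lattice_cone z /\ enorm (x - z) = dist_lattice x]].

Definition growth (theta : 'rV[R]_s) : R :=
  limn (fun k : nat => ln (mult (k%:R *: theta))%:R / k%:R : R).

End Directional_growth.

(* Main.v *)
Require Import Defs.
From mathcomp Require Import all_boot all_order all_algebra.
From mathcomp Require Import finmap.
From mathcomp Require Import all_classical all_reals all_analysis.
From mathcomp Require Import ring lra zify.

Set Implicit Arguments.
Unset Strict Implicit.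
Unset Printing Implicit Defensive.

Import Order.TTheory GRing.Theory Num.Theory.
Import numFieldNormedType.Exports.

Local Open Scope classical_set_scope.
Local Open Scope ring_scope.

(** A bi-Lipschitz bijection f : E -> F between dust-like sets need not send
    cylinders to cylinders, but it sends each cylinder E_w to a finite union of
    cylinders F_(j v) where j = J w has size comparable to that of E_w and the
    words v have a fixed length N ([geometric_coding]).  So, up to scaling, only
    finitely many pictures of f on a cylinder can occur.

    Let t be the exponent with sum tau_k^t = 1 and give F the self-similar
    probability with weights tau_k^t.  The mass of f(E_w) divided by rho_w^t is
    bounded above and below, and it is an average of the same quantity over the
    children of w (this forces sum rho_i^t = 1, [rho_sum]).  Finiteness of
    the pictures makes the ratio between the densities of a child and of its
    parent range over a finite set, so a density close enough to its supremum
    cannot increase any more, and being an average it is constant on all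
    descendants: f scales measure by a constant below some word w0
    ([density_locally_constant], the argument of Falconer and Marsh, and of
    Cooper and Pignataro).  Reading this off the finitely many pictures, the
    ratio tau_(J w) / rho_w takes finitely many values below w0.  In the
    coordinates given by the pseudo-basis this says that a word w over X is sent
    to a word J w over Y with kappa_Y (J w) - kappa_X w in a finite set of
    integer vectors, and that the words w with given kappa_X w and J w are
    boundedly many ([lattice_coding]).

    The rest is combinatorics of words in the lattice, for which the main tool
    is Dickson's lemma: in a set of vectors of natural numbers, every vector
    dominates a vector of the set with bounded entries.  Applied to the words
    J w for w = j j j ..., it produces a multiple of X_j in the semigroup
    generated by Y, whence the equality of the cones ([cone_sub]).  Applied to
    pairs of words with close values, it shows that boundedly many letters can
    be exchanged in a word of value z to obtain a word of value z', so the
    multiplicities of close lattice points differ at most by a factor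
    polynomial in the length of the words ([nwords_comparable]).  Hence
    m_X (k theta) and m_Y (k theta) agree up to a factor polynomial in k
    ([mult_compare]), which disappears in log m (k theta) / k.
    The two sequences then have the same limits, so the growth functions agree
    ([growth_eq]). *)

(** * Dickson's lemma *)

(** One coordinate at a time: a sequence of natural numbers has a monotone
    subsequence because a tail always contains a term that is minimal among the
    later ones, and passing to a further subsequence keeps the coordinates
    already treated monotone. *)
Lemma monotone_subseq (I : eqType) (r : seq I) (u : nat -> I -> nat) :
  exists2 phi : nat -> nat, {homo phi : k l / (k < l)%N} &
    forall i, i \in r -> {homo (fun k => u (phi k) i) : k l / (k <= l)%N}.
Proof.
elim: r => [|i r [phi phiS IH]]; first by exists id.
have next N : exists k, (N <= k)%N /\
    forall l, (N <= l)%N -> (u (phi k) i <= u (phi l) i)%N.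
  have ex : exists v, `[< exists2 k, (N <= k)%N & u (phi k) i = v >].
    by exists (u (phi N) i); apply/asboolP; exists N.
  case: (ex_minnP ex) => v /asboolP[k Nk <-] vmin.
  by exists k; split=> // l Nl; apply: vmin; apply/asboolP; exists l.
have [g gP] := choice next.
pose psi := fix psi k := if k is k'.+1 then g (psi k').+1 else g 0%N.
have psiS : {homo psi : k l / (k < l)%N}.
  by apply: homo_ltn => [? ? ? |k /=]; [exact: ltn_trans|case: (gP (psi k).+1)].
exists (phi \o psi) => [k l kl /=|j]; first exact/phiS/psiS.
rewrite inE => /predU1P[->{j}|/IH jr].
  apply: homo_leq => [//|? ? ? |k]; first exact: leq_trans.
  have /= lk := psiS k k.+1 (ltnSn k).
  case: k lk => [|k] lk /=; first by case: (gP 0%N) => _; apply.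
  by case: (gP (psi k).+1) => ak; apply; apply: leq_trans ak _; apply: ltnW.
by move=> k l kl /=; apply: jr; exact: (ltnW_homo psiS).
Qed.

(** If no bound M worked, the bad vectors c M would form a sequence with a
    monotone subsequence; a late term of it dominates the first one, whose
    entries are bounded, and is thus not bad. *)
Lemma dickson (I : finType) (P : (I -> nat) -> Prop) :
  exists M, forall c, P c ->
    exists e, [/\ P e, forall i, (e i <= c i)%N & forall i, (e i <= M)%N].
Proof.
apply: contrapT => noM.
have bad M : exists c, P c /\
    ~ exists e, [/\ P e, forall i, (e i <= c i)%N & forall i, (e i <= M)%N].
  apply: contrapT => nobad; apply: noM; exists M => c Pc.
  by apply: contrapT => ce; apply: nobad; exists c.
have [c cP] := choice bad.
have [phi phiS mono] := monotone_subseq (enum I) c.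
pose M0 := (\max_i c (phi 0%N) i)%N.
have leM0 : (M0 <= phi M0)%N.
  by elim: M0 => // k IH; apply: leq_ltn_trans IH _; apply: phiS.
case: (cP (phi M0)) => _; apply; exists (c (phi 0%N)); split.
- by case: (cP (phi 0%N)).
- by move=> i; apply: mono; rewrite ?mem_enum.
- by move=> i; apply: leq_trans leM0; rewrite /M0 leq_bigmax.
Qed.

(** * Counting words with a given value *)

Lemma leq_card_fset_set_inj (T U : choiceType) (A : set T) (B : set U)
    (f : T -> U) :
  finite_set A -> finite_set B -> (forall x, A x -> B (f x)) ->
  (forall x y, A x -> A y -> f x = f y -> x = y) ->
  (#|` fset_set A| <= #|` fset_set B|)%N.
Proof.
move=> finA finB AB finj.
rewrite -(size_map f (enum_fset (fset_set A))) uniq_leq_size //.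
  rewrite map_inj_in_uniq ?fset_uniq// => x y.
  by rewrite !in_fset_set// !inE => Ax Ay; apply: finj.
move=> _ /mapP[x + ->]; rewrite !in_fset_set// !inE; exact: AB.
Qed.

(** The bound on a multiplicity that is used throughout: a map to a finite
    type with small fibres. *)
Lemma leq_card_fset_set_fibers (T : choiceType) (P : finType) (A : set T)
    (g : T -> P) (N : nat) :
  finite_set A ->
  (forall p, (#|` fset_set (A `&` [set x | g x = p])| <= N)%N) ->
  (#|` fset_set A| <= #|P| * N)%N.
Proof.
move=> finA fib; rewrite -sum1_size (partition_big g xpredT)//= -sum_nat_const.
apply: leq_sum => p _.
rewrite sum1_count -size_filter; apply: leq_trans (fib p).
have finAp : finite_set (A `&` [set x | g x = p]).
  by apply: sub_finite_set finA => x [].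
rewrite uniq_leq_size ?filter_uniq ?fset_uniq// => x.
rewrite mem_filter in_fset_set// in_fset_set// => /andP[/eqP gx].
by rewrite !inE.
Qed.

Section words.
Variables (s m : nat) (X : 'I_m -> 'rV[int]_s).

(** The value of a word, kept in the integer lattice, where bounded sets are
    finite; the real vector kappa is its image. *)
Definition zkappa (w : seq 'I_m) : 'rV[int]_s := \sum_(i <- w) X i.

Definition nwords (z : 'rV[int]_s) : nat :=
  #|` fset_set [set w | zkappa w = z] |.

(** This finiteness condition is how the half-space hypothesis on X enters the
    counting. *)
Definition words_leq (z : 'rV[int]_s) (L : nat) : Prop :=
  forall w, zkappa w = z -> (size w <= L)%N.

Lemma zkappa_cat v w : zkappa (v ++ w) = zkappa v + zkappa w.
Proof. by rewrite /zkappa big_cat. Qed.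

Lemma zkappa_cons i w : zkappa (i :: w) = X i + zkappa w.
Proof. by rewrite /zkappa big_cons. Qed.

Lemma zkappa_count w : zkappa w = \sum_i X i *+ count_mem i w.
Proof.
elim: w => [|j w IH]; first by rewrite /zkappa big_nil big1.
rewrite zkappa_cons IH (bigD1 j)//= [in RHS](bigD1 j)//= eqxx mulrS -addrA.
congr (_ + (_ + _)); apply: eq_bigr => i; rewrite eq_sym => /negbTE ->.
by rewrite add0n.
Qed.

Lemma finite_words_leq z L : words_leq z L -> finite_set [set w | zkappa w = z].
Proof.
move=> zL; apply: (@sub_finite_set _ _ [set w | (size w <= L)%N]) => //.
elim: L {z zL} => [|L IH].
  apply: (@sub_finite_set _ _ [set [::]]); last exact: finite_set1.
  by move=> [].
apply: (@sub_finite_set _ _ ([set [::]] `|`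
  [set i :: w | i in [set: 'I_m] & w in [set w | (size w <= L)%N]])).
  by move=> [|i w] /= wL; [left|right; exists i => //; exists w].
by rewrite finite_setU; split; [exact: finite_set1|exact: finite_image2].
Qed.

Lemma nwords_addr z e L :
  words_leq (z + zkappa e) L -> (nwords z <= nwords (z + zkappa e))%N.
Proof.
move=> zeL.
apply: (@leq_card_fset_set_inj _ _ _ _ (fun w => w ++ e)).
- apply: (@finite_words_leq _ L) => w wz.
  by have := zeL (w ++ e); rewrite zkappa_cat wz size_cat => /(_ erefl); lia.
- exact: finite_words_leq zeL.
- by move=> w /= <-; rewrite zkappa_cat.
- move=> v w _ _ /eqP vwe.
  have vw : size v = size w.
    by have /eqP/(congr1 size) := vwe; rewrite !size_cat => /addIn.
  by move: vwe; rewrite eqseq_cat// => /andP[/eqP].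
Qed.

(** Deleting the letters of e one after the other loses only the positions
    at which they stood, and there are at most L.+1 choices for each. *)
Lemma nwords_delete e z L : words_leq z L ->
  (#|` fset_set [set w | zkappa w = z /\
        forall i, (count_mem i e <= count_mem i w)%N]|
   <= L.+1 ^ size e * nwords (z - zkappa e))%N.
Proof.
elim: e z => [|x e IH] z zL.
  rewrite expn0 mul1n /zkappa big_nil subr0.
  have fz := finite_words_leq zL.
  apply: (@leq_card_fset_set_inj _ _ _ _ id) => //; last by move=> w [].
  by apply: sub_finite_set fz => w [].
have zL' : words_leq (z - X x) L.
  by move=> w wz; have := zL (x :: w); rewrite zkappa_cons wz addrC subrK /=;
     move=> /(_ erefl)/ltnW.
rewrite expnS -mulnA zkappa_cons opprD addrA.
rewrite -[X in (_ <= X * _)%N]card_ord.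
have finz e' z' : words_leq z' L -> finite_set
    [set w | zkappa w = z' /\ forall i, (count_mem i e' <= count_mem i w)%N].
  by move=> /finite_words_leq; apply: sub_finite_set => w [].
apply: (@leq_card_fset_set_fibers _ _ _
  (fun w => inord (index x w))); first exact: finz.
move=> p; apply: leq_trans (IH _ zL').
have xw w : (forall i, (count_mem i (x :: e) <= count_mem i w)%N) -> x \in w.
  rewrite -has_pred1 has_count => /(_ x) /=; rewrite eqxx.
  exact: leq_trans.
apply: (@leq_card_fset_set_inj _ _ _ _ (rem x)).
- by apply: sub_finite_set (finz (x :: e) z zL) => w [].
- exact: finz.
- move=> w /= [[wz ew] _]; have pw := perm_to_rem (xw w ew); split.
    by rewrite -wz /zkappa (perm_big _ pw) /= big_cons [X x + _]addrC addrK.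
  by move=> i; have := ew i; rewrite (permP pw) /= leq_add2l.
- move=> v w /= [[vz /xw xv] vp] [[wz /xw xw'] wp].
  have ivw : index x v = index x w.
    have iL u : zkappa u = z -> (index x u < L.+1)%N.
      by move=> /zL; rewrite ltnS; apply: leq_trans (index_size x u).
    have := congr1 (@nat_of_ord _) (etrans vp (esym wp)).
    by rewrite !inordK ?iL.
  have kv : (index x w < size v)%N by rewrite -ivw index_mem.
  have kw : (index x w < size w)%N by rewrite index_mem.
  rewrite !remE ivw => /eqP; rewrite eqseq_cat; last first.
    by rewrite !size_takel ?(ltnW kv) ?(ltnW kw).
  move=> /andP[/eqP eT /eqP eD].
  rewrite -[LHS](cat_take_drop (index x w)) -[RHS](cat_take_drop (index x w)).
  rewrite (drop_nth x kv) (drop_nth x kw) -[in nth x v _]ivw !nth_index// eT.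
  by rewrite eD.
Qed.

Definition vword (e : 'I_m -> nat) : seq 'I_m :=
  flatten [seq nseq (e i) i | i <- enum 'I_m].

Lemma count_vword e i : count_mem i (vword e) = e i.
Proof.
rewrite /vword count_flatten -map_comp sumnE big_map big_enum /=.
rewrite (bigD1 i)//= big1 ?addn0 ?count_nseq /= ?eqxx ?mul1n// => j /negbTE ji.
by rewrite count_nseq /= ji.
Qed.

Lemma zkappa_vword e : zkappa (vword e) = \sum_i X i *+ e i.
Proof. by rewrite zkappa_count; apply: eq_bigr => i _; rewrite count_vword. Qed.

Lemma size_vword e M : (forall i, (e i <= M)%N) -> (size (vword e) <= m * M)%N.
Proof.
move=> eM; rewrite /vword size_flatten /shape -map_comp sumnE big_map big_enum.
rewrite -[X in (X * _)%N]card_ord -sum_nat_const.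
by apply: leq_sum => i _; rewrite /= size_nseq.
Qed.

(** Dickson's lemma for the pairs of letter counts of (v, w) with a prescribed
    difference of values: the subwords e of v and f of w of bounded size carry
    the whole difference. *)
Lemma dickson_words (B : seq 'rV[int]_s) : exists M, forall v w,
  zkappa v - zkappa w \in B -> exists e f : 'I_m -> nat,
  [/\ forall i, (e i <= count_mem i v)%N, forall i, (f i <= count_mem i w)%N,
      forall i, (e i <= M)%N, forall i, (f i <= M)%N &
      zkappa (vword e) - zkappa (vword f) = zkappa v - zkappa w].
Proof.
have dk b : exists M, forall v w,
  zkappa v - zkappa w = b -> exists e f : 'I_m -> nat,
  [/\ forall i, (e i <= count_mem i v)%N, forall i, (f i <= count_mem i w)%N,
      forall i, (e i <= M)%N, forall i, (f i <= M)%N &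
      zkappa (vword e) - zkappa (vword f) = b].
  have [M MP] := @dickson ('I_m + 'I_m)%type (fun c =>
    \sum_i X i *+ c (inl i) - \sum_i X i *+ c (inr i) = b).
  exists M => v w vwb.
  have [|e [eb ec eM]] := MP (fun i => match i with inl i => count_mem i v
    | inr i => count_mem i w end); first by rewrite -!zkappa_count.
  exists (e \o inl), (e \o inr); split=> [i|i|i|i|]; [exact: (ec (inl i))|
    exact: (ec (inr i))|exact: eM|exact: eM|].
  by rewrite !zkappa_vword.
have [M MP] := choice dk.
exists (\max_(b <- B) M b)%N => v w vwB.
have [e [f [ev fw eM fM efb]]] := MP _ v w erefl.
have MM : (M (zkappa v - zkappa w)%R <= \max_(b <- B) M b)%N.
  exact: leq_bigmax_seq.
by exists e, f; split=> // i; apply: leq_trans MM.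
Qed.

(** By [dickson_words], in every word of value z one can delete a bounded
    subword e and append a bounded word f so as to reach the value of w.  The
    new word determines the old one up to the positions of the deleted letters
    and the choice of (e, f), whence a factor which is polynomial in L. *)
Lemma nwords_comparable (B : seq 'rV[int]_s) : exists K E, forall z w L L',
  z - zkappa w \in B -> words_leq z L -> words_leq (zkappa w) L' ->
  (nwords z <= K * L.+1 ^ E * nwords (zkappa w))%N.
Proof.
have [M MP] := dickson_words B.
pose P := ({ffun 'I_m -> 'I_M.+1} * {ffun 'I_m -> 'I_M.+1})%type.
pose tow (p : {ffun 'I_m -> 'I_M.+1}) := vword (fun i => p i).
(* The type P lists the pairs (e, f) of bounded letter counts. *)
exists #|{: P}|, (m * M)%N => z w L L' zwB zL wL'.
have gex v : exists p : P, zkappa v = z ->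
    (forall i, (count_mem i (tow p.1) <= count_mem i v)%N) /\
    zkappa (tow p.1) - zkappa (tow p.2) = z - zkappa w.
  have [vz|nvz] := pselect (zkappa v = z); last first.
    by exists ([ffun=> ord0], [ffun=> ord0]).
  have [|e [f [ev _ eM fM efb]]] := MP v w; first by rewrite vz.
  exists ([ffun i => inord (e i)], [ffun i => inord (f i)]) => _.
  have tE (h : 'I_m -> nat) : (forall i, (h i <= M)%N) ->
      tow [ffun i => inord (h i)] = vword h.
    move=> hM; rewrite /tow /vword; congr flatten; apply: eq_map => i.
    by rewrite ffunE inordK// ltnS.
  by rewrite /= !tE// -vz efb; split=> // i; rewrite count_vword.
have [g gP] := choice gex.
rewrite -mulnA.
apply: (leq_card_fset_set_fibers (g := g)); first exact: finite_words_leq zL.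
move=> p.
have fin : finite_set ([set v | zkappa v = z] `&` [set v | g v = p]).
  by apply: sub_finite_set (finite_words_leq zL) => v [].
have [[v [/= vz gv]]|empty] :=
    pselect (exists v, ([set v | zkappa v = z] `&` [set v | g v = p]) v);
  last first.
  rewrite (_ : _ `&` _ = set0) ?fset_set0// -subset0 => v vp.
  by apply: empty; exists v.
have [_ pb] := gP v vz; rewrite gv in pb.
have wE : zkappa w = (z - zkappa (tow p.1)) + zkappa (tow p.2).
  rewrite -addrA [- _ + _]addrC -(opprB (zkappa (tow p.1))) pb.
  by rewrite opprB addrC subrK.
have szp : (size (tow p.1) <= m * M)%N.
  by apply: size_vword => i; rewrite -ltnS ltn_ord.
apply: (@leq_trans (L.+1 ^ size (tow p.1) * nwords (z - zkappa (tow p.1)))%N).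
  apply: leq_trans (nwords_delete (tow p.1) zL).
  apply: (@leq_card_fset_set_inj _ _ _ _ id) => //.
    by apply: sub_finite_set (finite_words_leq zL) => u [].
  move=> u /= [uz gu]; split=> //.
  by have [+ _] := gP u uz; rewrite gu.
apply: leq_mul; first by rewrite leq_pexp2l.
by rewrite wE; apply: (@nwords_addr _ _ L'); rewrite -wE.
Qed.

End words.

(** * The Euclidean norm *)

(** The initial value 1 of the minimum also covers the empty family. *)
Lemma fin_pos_lb (R : realFieldType) (I : finType) (f : I -> R) :
  (forall i, 0 < f i) -> exists2 c, 0 < c & forall i, c <= f i.
Proof.
move=> f0; exists (\big[Num.min/1]_i f i).
  by elim/big_ind: _ => // x y *; rewrite lt_min; apply/andP.
by move=> i; rewrite (bigD1 i)//= ge_min lexx.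
Qed.

Section enorm.
Variables (R : realType) (d : nat).
Implicit Types x y : 'rV[R]_d.

Lemma enorm_ge0 x : 0 <= enorm x. Proof. exact: sqrtr_ge0. Qed.

Lemma coord_le_enorm x i : `|x ord0 i| <= enorm x.
Proof.
rewrite -sqrtr_sqr ler_wsqrtr// (bigD1 i)//= lerDl.
by apply: sumr_ge0 => j _; exact: sqr_ge0.
Qed.

Lemma enorm_eq0 x : enorm x = 0 -> x = 0.
Proof.
move=> x0; apply/rowP => i; rewrite mxE; apply/eqP.
by rewrite -normr_le0 -x0 coord_le_enorm.
Qed.

Lemma enorm_le_sum x : enorm x <= \sum_i `|x ord0 i|.
Proof.
rewrite -[leRHS]ger0_norm ?sumr_ge0// -sqrtr_sqr ler_wsqrtr//.
suff /andP[] : (0 <= \sum_i `|x ord0 i|) &&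
  (\sum_i x ord0 i ^+ 2 <= (\sum_i `|x ord0 i|) ^+ 2) by [].
elim/big_rec2: _ => [|i a b _ /andP[a0 ba]]; first by rewrite expr0n lexx.
rewrite addr_ge0//= sqrrD real_normK ?num_real// -addrA lerD2l.
by rewrite (le_trans ba)// lerDr mulrn_wge0// mulr_ge0.
Qed.

Lemma mx_norm_le_enorm x : `|x| <= enorm x.
Proof.
rewrite [leLHS]/Num.Def.normr/= mx_normrE (bigmax_le _ (enorm_ge0 x))//=.
by move=> [i j] _ /=; rewrite (ord1 i) coord_le_enorm.
Qed.

Lemma enorm_le_mx_norm x : enorm x <= d%:R * `|x|.
Proof.
apply: le_trans (enorm_le_sum x) _.
rewrite mulr_natl -[X in _ *+ X]card_ord -sumr_const; apply: ler_sum => i _.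
rewrite [leRHS]/Num.Def.normr/= mx_normrE.
by apply/bigmax_geP; right; exists (ord0, i).
Qed.

Lemma continuous_enorm : continuous (@enorm R d).
Proof.
move=> x.
apply: (@continuous_comp _ _ _
  (fun x : 'rV[R]_d => \sum_i x ord0 i ^+ 2)).
  apply: (@cvg_big R _ +%R 0 xpredT add_continuous _ (nbhs x)) => i _.
  apply: (@continuous_comp _ _ _
    (fun x : 'rV[R]_d => x ord0 i) (fun u => u ^+ 2)).
    exact: coord_continuous.
  exact: exprn_continuous.
exact: sqrt_continuous.
Qed.

(** The topology is that of the sup norm, so both comparisons between the
    sup norm and the Euclidean norm are needed. *)
Lemma continuous_similarity (r : R) (phi : 'rV[R]_d -> 'rV[R]_d) :
  similarity r phi -> continuous phi.
Proof.
move=> sim x; have FF : Filter (nbhs x) := nbhs_filter x.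
apply/(@cvgrPdist_lt _ _ _ _ FF) => e e0.
have [r0|r0] := leP r 0.
  apply: nearW => y; rewrite (_ : phi x - phi y = 0) ?normr0//.
  apply: enorm_eq0.
  apply: le_anti; rewrite enorm_ge0 andbT sim.
  by rewrite mulr_le0_ge0// enorm_ge0.
have c0 : 0 < r * d.+1%:R by rewrite mulr_gt0.
have xe : \forall y \near x, `|x - y| < e / (r * d.+1%:R).
  apply: (@cvgr_dist_lt _ _ _ (nbhs x) _ id x) => //; exact: divr_gt0.
apply: filterS xe => y xy.
apply: le_lt_trans (mx_norm_le_enorm _) _; rewrite sim.
apply: (@le_lt_trans _ _ (r * d.+1%:R * `|x - y|)).
  rewrite -mulrA ler_pM2l//; apply: le_trans (enorm_le_mx_norm _) _.
  by rewrite ler_wpM2r// ler_nat.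
by rewrite mulrC -ltr_pdivlMr.
Qed.

End enorm.

(** * Words, weights and cylinders *)

Section word_weight.
Variables (R : realFieldType) (m : nat) (rho : 'I_m -> R).
Hypothesis rho01 : forall j, 0 < rho j < 1.

Definition wweight (w : seq 'I_m) : R := \prod_(i <- w) rho i.

Lemma wweight_nil : wweight [::] = 1. Proof. exact: big_nil. Qed.

Lemma wweight_cons i w : wweight (i :: w) = rho i * wweight w.
Proof. exact: big_cons. Qed.

Lemma wweight_cat v w : wweight (v ++ w) = wweight v * wweight w.
Proof. exact: big_cat. Qed.

Lemma wweight_rcons w i : wweight (rcons w i) = wweight w * rho i.
Proof. by rewrite -cats1 wweight_cat wweight_cons wweight_nil mulr1. Qed.

Lemma wweight_gt0 w : 0 < wweight w.
Proof.
by elim: w => [|i w IH]; rewrite ?wweight_nil ?wweight_cons ?mulr_gt0//;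
  case/andP: (rho01 i).
Qed.

Lemma wweight_le1 w : wweight w <= 1.
Proof.
elim: w => [|i w IH]; first by rewrite wweight_nil.
by rewrite wweight_cons mulr_ile1// ?ltW ?wweight_gt0//; case/andP: (rho01 i).
Qed.

Lemma wweight_lt1 w : w != [::] -> wweight w < 1.
Proof.
case: w => // i w _; rewrite wweight_cons.
case/andP: (rho01 i) => r0 r1; apply: le_lt_trans r1.
by rewrite ger_pMr// wweight_le1.
Qed.

Lemma wweight_le_exp r w : (forall i, rho i <= r) -> wweight w <= r ^+ size w.
Proof.
move=> hr; elim: w => [|i w IH]; first by rewrite wweight_nil.
rewrite wweight_cons exprS ler_pM// ?ltW ?wweight_gt0//.
by case/andP: (rho01 i).
Qed.

Lemma wweight_ge_exp r w : 0 <= r -> (forall i, r <= rho i) ->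
  r ^+ size w <= wweight w.
Proof.
move=> r0 hr; elim: w => [|i w IH]; first by rewrite wweight_nil.
by rewrite wweight_cons exprS ler_pM// exprn_ge0.
Qed.

Lemma ratio_lb : exists2 r, 0 < r & forall i, r <= rho i.
Proof. by apply: fin_pos_lb => i; case/andP: (rho01 i). Qed.

Lemma ratio_ub : exists2 r, 0 < r < 1 & forall i, rho i <= r.
Proof.
have [|c c0 hc] := @fin_pos_lb R _ (fun i => 1 - rho i).
  by move=> i; rewrite subr_gt0; case/andP: (rho01 i).
exists (Num.max (1 - c) 2^-1) => [|i].
  rewrite lt_max gt_max; apply/andP; split; first by apply/orP; right; lra.
  by apply/andP; split; lra.
by rewrite le_max lerBrDl -lerBrDr hc.
Qed.

End word_weight.

Lemma expr_lt_eventually (R : realType) (r e : R) :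
  0 < r < 1 -> 0 < e -> exists N, r ^+ N < e.
Proof.
move=> /andP[r0 r1] e0.
have /cvgrPdist_lt/(_ e e0)[N _ /(_ N)] : r ^+ n @[n --> \oo] --> 0.
  by apply: cvg_expr; rewrite ger0_norm// ltW.
rewrite /= leqnn sub0r normrN ger0_norm ?exprn_ge0 ?ltW// => /(_ erefl) ?.
by exists N.
Qed.

Section cylinders.
Variables (R : realType) (d m : nat) (rho : 'I_m -> R).
Variables (phi : 'I_m -> 'rV[R]_d -> 'rV[R]_d) (E : set 'rV[R]_d).
Hypothesis rho01 : forall j, 0 < rho j < 1.
Hypothesis sim : forall j, similarity (rho j) (phi j).
Hypothesis attrE : attractor phi E.
Hypothesis dustE : trivIset setT (fun j => phi j @` E).

Let E0 : E !=set0. Proof. by case: attrE. Qed.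
Let Ecompact : compact E. Proof. by case: attrE. Qed.
Let Eunion : E = \bigcup_j (phi j @` E). Proof. by case: attrE. Qed.

Definition cyl (w : seq 'I_m) : set 'rV[R]_d :=
  foldr (fun i A => phi i @` A) E w.

Lemma cyl_sub w : cyl w `<=` E.
Proof.
elim: w => [|i w IH] //= _ [x wx <-]; rewrite Eunion.
by exists i => //; exists x => //; exact: IH.
Qed.

Lemma cyl_cat_sub v w : cyl (v ++ w) `<=` cyl v.
Proof.
elim: v => [|i v IH] /=; first exact: cyl_sub.
by move=> _ [x vwx <-]; exists x => //; exact: IH.
Qed.

Lemma cyl_rcons_sub w i : cyl (rcons w i) `<=` cyl w.
Proof. by rewrite -cats1; exact: cyl_cat_sub. Qed.

Lemma cyl_rcons w x : cyl w x -> exists i, cyl (rcons w i) x.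
Proof.
elim: w x => [|j w IH] x /=.
  by rewrite {1}Eunion => -[i _ [y Ey <-]]; exists i; exists y.
by move=> [y /IH[i wy] <-]; exists i; exists y.
Qed.

Lemma cyl_extend w x N : cyl w x -> exists2 v, size v = N & cyl (w ++ v) x.
Proof.
move=> wx; elim: N => [|N [v sv wvx]].
  by exists [::] => //; rewrite cats0.
have [i] := cyl_rcons wvx; rewrite -cats1 -catA => wvix.
by exists (rcons v i); rewrite ?size_rcons ?sv// -cats1.
Qed.

Lemma cyl_neq0 w : cyl w !=set0.
Proof.
elim: w => [|i w [x wx]] //=; by exists (phi i x); exists x.
Qed.

Lemma phi_inj i : injective (phi i).
Proof.
move=> x y xy; apply/eqP; rewrite -subr_eq0; apply/eqP/enorm_eq0/eqP.
have := sim i x y; rewrite xy subrr => /esym/eqP.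
rewrite (_ : enorm 0 = 0) ?mulf_eq0 => [/orP[/eqP r0|//]|].
  by move: (rho01 i); rewrite r0 ltxx.
by rewrite /enorm big1 ?sqrtr0// => j _; rewrite mxE expr0n.
Qed.

(** In a dust-like set two cylinders are nested or disjoint, as the first
    letters of two words can be read off a common point. *)
Lemma cyl_meet v w x : cyl v x -> cyl w x -> (size v <= size w)%N ->
  exists u, w = v ++ u.
Proof.
elim: v w x => [|i v IH] w x; first by exists w.
case: w => // j w /= [y vy <-] [z wz] zy vw.
have ij : i = j.
  apply: (dustE (i := i) (j := j)) => //.
  exists (phi i y); split; first by exists y => //; exact: cyl_sub vy.
  by exists z => //; exact: cyl_sub wz.
have wy : cyl w y by move: zy; rewrite -ij => /phi_inj <-.
by have [u ->] := IH w y vy wy vw; rewrite ij; exists u.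
Qed.

(** A proper extension of a word has a strictly smaller weight, so nested
    cylinders of the same weight coincide as words. *)
Lemma cyl_inj_weight v w x : cyl v x -> cyl w x ->
  wweight rho v = wweight rho w -> v = w.
Proof.
wlog : v w / (size v <= size w)%N => [H vx wx vw|vw vx wx].
  by case: (leqP (size v) (size w)) => [|/ltnW] ?; [|symmetry]; apply: H.
have [u ->] := cyl_meet vx wx vw.
case: (eqVneq u [::]) => [->|u0]; first by rewrite cats0.
rewrite wweight_cat => /esym/eqP; rewrite -subr_eq0 -{2}[wweight rho v]mulr1.
rewrite -mulrBr mulf_eq0 gt_eqF ?wweight_gt0//= subr_eq0 => /eqP u1.
by have := wweight_lt1 rho01 u0; rewrite u1 ltxx.
Qed.

Lemma cyl_diam : exists2 D, 0 < D & forall w x y, cyl w x -> cyl w y ->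
  enorm (x - y) <= D * wweight rho w.
Proof.
have [D D0 hD] : exists2 D, 0 < D &
    forall x y, E x -> E y -> enorm (x - y) <= D.
  have [M [Mr MP]] := compact_bounded Ecompact.
  pose M' := `|M| + 1.
  have M'E x : E x -> `|x| <= M'.
    move=> Ex; apply: MP => //.
    by rewrite /M' (le_lt_trans (ler_norm _))// ltrDl.
  exists (d.+1%:R * (M' + M')) => [|x y Ex Ey].
    by rewrite mulr_gt0// addr_gt0// /M' ltr_pwDr.
  apply: le_trans (enorm_le_mx_norm _) _; apply: ler_pM => //.
    by rewrite ler_nat.
  by rewrite (le_trans (ler_normB _ _))// lerD// M'E.
exists D => //; elim=> [|i w IH] x y.
  by rewrite wweight_nil mulr1; exact: hD.
move=> /= [x' wx <-] [y' wy <-]; rewrite sim wweight_cons mulrCA.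
by rewrite ler_wpM2l ?IH//; case/andP: (rho01 i) => /ltW.
Qed.

Lemma compact_gap (A B : set 'rV[R]_d) : compact A -> compact B ->
  A `&` B = set0 ->
  exists2 c, 0 < c & forall x y, A x -> B y -> c <= enorm (x - y).
Proof.
move=> cA cB AB0.
pose g (p : 'rV[R]_d * 'rV[R]_d) := enorm (p.1 - p.2).
have cg : continuous g.
  move=> p; apply: (@continuous_comp _ _ _
    (fun p : 'rV[R]_d * 'rV[R]_d => p.1 - p.2)).
    exact: sub_continuous.
  exact: continuous_enorm.
have cgAB : compact (g @` (A `*` B)).
  apply: continuous_compact; last exact: compact_setX.
  exact: continuous_subspaceT.
have clg := compact_closed (@Rhausdorff R) cgAB.
have n0 : (~` (g @` (A `*` B))) 0.
  move=> [[x y] [/= Ax By]] /enorm_eq0/subr0_eq xy.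
  suff : (A `&` B) x by rewrite AB0.
  by split=> //; rewrite [x]xy.
have [e e0 he] : \forall t \near (0 : R), (~` (g @` (A `*` B))) t.
  by apply: open_nbhs_nbhs; split => //; exact: closed_openC.
exists e => // x y Ax By; rewrite leNgt; apply/negP => xe.
apply: (he (enorm (x - y))); last by exists (x, y).
by rewrite /= sub0r normrN ger0_norm ?enorm_ge0.
Qed.

(** Self-similarity scales the positive distance between the disjoint compact
    first-level pieces down to all levels. *)
Lemma cyl_gap : exists2 c, 0 < c & forall w x y, cyl w x -> E y -> ~ cyl w y ->
  c * wweight rho w <= enorm (x - y).
Proof.
have gap (p : 'I_m * 'I_m) : exists c, 0 < c /\ (p.1 != p.2 ->
    forall x y, (phi p.1 @` E) x -> (phi p.2 @` E) y -> c <= enorm (x - y)).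
  have [p12|p12] := eqVneq p.1 p.2; first by exists 1.
  have cE i : compact (phi i @` E).
    apply: continuous_compact => //; apply: continuous_subspaceT.
    exact: continuous_similarity (sim i).
  have [|c c0 hc] := @compact_gap (phi p.1 @` E) (phi p.2 @` E) (cE _) (cE _).
    by have /trivIsetP := dustE; apply.
  by exists c.
have [c cP] := choice gap.
have [|e e0 he] := @fin_pos_lb R _ c; first by move=> p; case: (cP p).
exists e => //; elim=> [|i w IH] x y //= [x' wx <-] Ey nwy.
move: (Ey); rewrite {1}Eunion => -[j _ [y' Ey' jy]].
have [ij|ij] := eqVneq i j.
  rewrite -jy -ij sim wweight_cons mulrCA ler_wpM2l//.
    by case/andP: (rho01 i) => /ltW.
  by apply: IH => // wy'; apply: nwy; exists y' => //; rewrite ij.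
apply: (@le_trans _ _ e); first by rewrite ger_pMr// wweight_le1.
have [_ /(_ ij)/= gij] := cP (i, j).
apply: (le_trans (he (i, j))); apply: gij.
  by exists x' => //; exact: cyl_sub wx.
by exists y'.
Qed.

(** The longest word coding x whose weight is still at least r; its weight
    exceeds r by at most a factor 1 / rmin. *)
Lemma cyl_scale r rmin x : E x -> 0 < r <= 1 -> (forall i, rmin <= rho i) ->
  exists u, [/\ cyl u x, r <= wweight rho u & wweight rho u * rmin < r].
Proof.
move=> Ex /andP[r0 r1] hmin.
have [q q01 hq] := ratio_ub rho01.
have [N Nr] := expr_lt_eventually q01 r0.
have [u su ux] := @cyl_extend [::] x N Ex.
have : wweight rho u < r.
  by apply: le_lt_trans Nr; rewrite -su; exact: wweight_le_exp.
elim/last_ind: u {su} ux => [|u i IH] ux; first by rewrite wweight_nil ltNge r1.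
rewrite wweight_rcons => uir.
have [ru|ru] := leP r (wweight rho u); last first.
  by apply: IH ru; exact: cyl_rcons_sub ux.
exists u; split=> //; first exact: cyl_rcons_sub ux.
by apply: le_lt_trans uir; rewrite ler_wpM2l// ltW// wweight_gt0.
Qed.

End cylinders.

(** * Self-similar weights on words of a given length *)

Section cylinder_measure.
Variables (R : realFieldType) (n : nat) (wt : 'I_n -> R).
Hypothesis wt_ge0 : forall k, 0 <= wt k.

(** The sum over the words u of length N of the weight of u times p u.  When p
    indicates the cylinders contained in a union of cylinders of level N, this
    is the self-similar measure of that union. *)
Fixpoint nu (N : nat) (p : seq 'I_n -> R) : R :=
  if N is N'.+1 then \sum_k wt k * nu N' (fun u => p (k :: u)) else p [::].

Lemma eq_nu N p q : (forall u, size u = N -> p u = q u) -> nu N p = nu N q.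
Proof.
elim: N p q => [|N IH] p q pq /=; first exact: pq.
by apply: eq_bigr => k _; congr (_ * _); apply: IH => u uN; rewrite pq//= uN.
Qed.

Lemma nu0 N : nu N (fun=> 0) = 0.
Proof. by elim: N => //= N IH; rewrite big1// => k _; rewrite IH mulr0. Qed.

Lemma nu_sum (I : finType) N (p : I -> seq 'I_n -> R) :
  nu N (fun u => \sum_i p i u) = \sum_i nu N (p i).
Proof.
elim: N p => [|N IH] p //=; rewrite exchange_big /=.
by apply: eq_bigr => k _; rewrite IH mulr_sumr.
Qed.

Lemma nu_ge0 N p : (forall u, 0 <= p u) -> 0 <= nu N p.
Proof.
by elim: N p => [|N IH] p p0 //=; apply: sumr_ge0 => k _; rewrite mulr_ge0 ?IH.
Qed.

Lemma le_nu v N p : (forall u, 0 <= p u) -> size v = N ->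
  wweight wt v * p v <= nu N p.
Proof.
elim: N v p => [|N IH] [|k v] p p0 //=; first by rewrite wweight_nil mul1r.
move=> [vN]; rewrite (bigD1 k)//= wweight_cons -mulrA.
apply: ler_wpDr; first by apply: sumr_ge0 => i _; rewrite mulr_ge0// nu_ge0.
by rewrite ler_wpM2l//; apply: (IH v (fun u => p (k :: u))).
Qed.

(** A function supported on the extensions of j is integrated by restricting
    it below j and scaling. *)
Lemma nu_cat j N p :
  (forall u, size u = (size j + N)%N -> p u != 0 -> exists v, u = j ++ v) ->
  nu (size j + N) p = wweight wt j * nu N (fun v => p (j ++ v)).
Proof.
elim: j p => [|k j IH] p pj; first by rewrite wweight_nil mul1r.
rewrite /= (bigD1 k)//= [X in _ + X]big1 ?addr0.
  rewrite wweight_cons -mulrA (IH (fun u => p (k :: u)))// => u uj pu.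
  by have [|v [->]] := pj (k :: u) _ pu; [rewrite /= uj|exists v].
move=> i ik; rewrite (@eq_nu _ _ (fun=> 0)) => [|u uj].
  by rewrite nu0 mulr0.
apply/eqP/negPn/negP => /(pj (i :: u)); rewrite /= uj => /(_ erefl)[v [ik' _]].
by rewrite ik' eqxx in ik.
Qed.

(** There are finitely many sets of words of length N.  All finiteness
    statements about measures below come from this. *)
Lemma finite_nu_values N : exists S : seq R, forall b : seq 'I_n -> bool,
  nu N (fun u => (b u)%:R) \in S.
Proof.
pose tob (h : {ffun N.-tuple 'I_n -> bool}) (u : seq 'I_n) :=
  if insub u is Some t then h t else false.
exists [seq nu N (fun u => (tob h u)%:R) |
         h : {ffun N.-tuple 'I_n -> bool}] => b.
apply/fintype.imageP; exists [ffun t : N.-tuple 'I_n => b t] => //.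
apply: eq_nu => u uN; rewrite /tob; case: insubP => [t _ tu|].
  by rewrite ffunE tu.
by rewrite uN eqxx.
Qed.

Hypothesis wt_sum : \sum_k wt k = 1.

Lemma nu_le1 N p : (forall u, p u <= 1) -> nu N p <= 1.
Proof.
elim: N p => [|N IH] p p1 //=; rewrite -wt_sum; apply: ler_sum => k _.
by rewrite ler_piMr// IH.
Qed.

(** Since the weights sum to 1, refining the level does not change the
    measure of a union of cylinders. *)
Lemma nu_stable N k p : (forall u v, size u = N -> p (u ++ v) = p u) ->
  nu (N + k) p = nu N p.
Proof.
elim: N p => [|N IH] p pN.
  rewrite add0n /=; elim: k => [|k IHk] //=.
  under eq_bigr => i _.
    rewrite (@eq_nu _ _ p) => [|u _]; last by rewrite (pN [::])// -(pN [::] u).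
    rewrite IHk; over.
  by rewrite -mulr_suml wt_sum mul1r.
rewrite addSn /=; apply: eq_bigr => i _; congr (_ * _).
by apply: (IH (fun u => p (i :: u))) => u v uN; rewrite -cat_cons pN//= uN.
Qed.

End cylinder_measure.

(** * Bi-Lipschitz maps act on words *)

(** What remains of a bi-Lipschitz map on the level of words: ins w u stands for
    the inclusion of the cylinder of u in the image of the cylinder of w, J w
    for a cylinder containing that image and of comparable size.  The constant N
    bounds how deep below J w one has to look for the image of the cylinder of
    w, or of one of its children, to be a union of cylinders. *)
Record coding (R : realType) (m n : nat) (rho : 'I_m -> R) (tau : 'I_n -> R)
    (ins : seq 'I_m -> seq 'I_n -> bool) (J : seq 'I_m -> seq 'I_n)
    (N : nat) (a b : R) : Prop := Coding {
  coding_scale : forall w, a * wweight rho w <= wweight tau (J w) <=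
                             b * wweight rho w;
  coding_cat : forall w u v, ins w u -> ins w (u ++ v);
  coding_anchor : forall w u, (size (J w) <= size u)%N -> ins w u ->
    exists v, u = J w ++ v;
  coding_deep : forall w u v, (size (J w) + N <= size u)%N ->
    ins w (u ++ v) -> ins w u;
  coding_deep_child : forall w i u v, (size (J w) + N <= size u)%N ->
    ins (rcons w i) (u ++ v) -> ins (rcons w i) u;
  coding_split : forall w u, (size (J w) + N <= size u)%N -> ins w u ->
    exists i, ins (rcons w i) u;
  coding_parent : forall w i u, ins (rcons w i) u -> ins w u;
  coding_inj : forall w w' u, ins w u -> ins w' u ->
    wweight rho w = wweight rho w' -> w = w';
  coding_disjoint : forall w i i' u, ins (rcons w i) u -> ins (rcons w i') u ->
    i = i';
  coding_ex : forall w, exists2 v, size v = N & ins w (J w ++ v)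
}.

Section geometric_coding.
Variables (R : realType) (d m n : nat) (rho : 'I_m -> R) (tau : 'I_n -> R).
Variables (phi : 'I_m -> 'rV[R]_d -> 'rV[R]_d) (E : set 'rV[R]_d).
Variables (psi : 'I_n -> 'rV[R]_d -> 'rV[R]_d) (F : set 'rV[R]_d).
Hypothesis rho01 : forall j, 0 < rho j < 1.
Hypothesis simE : forall j, similarity (rho j) (phi j).
Hypothesis attrE : attractor phi E.
Hypothesis dustE : trivIset setT (fun j => phi j @` E).
Hypothesis tau01 : forall j, 0 < tau j < 1.
Hypothesis simF : forall j, similarity (tau j) (psi j).
Hypothesis attrF : attractor psi F.
Hypothesis dustF : trivIset setT (fun j => psi j @` F).
Variables (f : 'rV[R]_d -> 'rV[R]_d) (C : R).
Hypothesis fbij : set_bij E F f.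
Hypothesis C0 : 0 < C.
Hypothesis flip : forall x y, E x -> E y ->
  C^-1 * enorm (x - y) <= enorm (f x - f y) <= C * enorm (x - y).

Local Notation cE := (cyl phi E).
Local Notation cF := (cyl psi F).
Local Notation rw := (wweight rho).
Local Notation tw := (wweight tau).

Let fF x : E x -> F (f x).
Proof. by case: fbij => fS _ _ Ex; exact: fS. Qed.

Let f_inj x y : E x -> E y -> f x = f y -> x = y.
Proof. by case: fbij => _ fI _ Ex Ey; apply: fI; rewrite inE. Qed.

Let f_surj y : F y -> exists2 x, E x & f x = y.
Proof. by case: fbij => _ _ fS Fy; have [x Ex xy] := fS y Fy; exists x. Qed.

(** The image of a cylinder has diameter at most C D rho_w, so it lies in
    every cylinder of F that meets it and whose distance to the rest of F is
    larger than this; choose one of the smallest. *)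
Lemma image_cyl_anchor : exists a b, [/\ 0 < a, 0 < b & forall w, exists j,
  f @` cE w `<=` cF j /\ a * rw w <= tw j <= b * rw w].
Proof.
have [D D0 hD] := cyl_diam rho01 simE attrE.
have [c c0 hc] := cyl_gap tau01 simF attrF dustF.
have [t0 t00 ht0] := ratio_lb tau01.
pose K := (C * D + 1) / c.
have K0 : 0 < K by rewrite divr_gt0// addr_gt0// mulr_gt0.
(* The summand K covers the words so large that only the whole of F, with
   weight 1, is available as anchor. *)
exists (Num.min K 1), (K + K / t0); split.
- by rewrite lt_min K0 ltr01.
- by rewrite addr_gt0// divr_gt0.
move=> w; have r0 := wweight_gt0 rho01 w; have r1 := wweight_le1 rho01 w.
have [K1|K1] := leP (K * rw w) 1; last first.
  exists [::]; split.
    by move=> _ [x wx <-]; apply: fF; exact: (cyl_sub attrE wx).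
  rewrite wweight_nil; apply/andP; split.
    apply: mulr_ile1; rewrite ?(ltW r0)//; last by rewrite ge_min lexx orbT.
    by rewrite le_min (ltW K0) ler01.
  by rewrite mulrDl (le_trans (ltW K1))// lerDl ltW// mulr_gt0// divr_gt0.
have [x0 wx0] := cyl_neq0 attrE w.
have Ex0 := cyl_sub attrE wx0.
have Kr0 : 0 < K * rw w by rewrite mulr_gt0.
have [|j [jx0 Kj jK]] := cyl_scale tau01 attrF (fF Ex0) _ ht0 (r := K * rw w).
  by rewrite Kr0 K1.
exists j; split; last first.
  apply/andP; split.
    by apply: le_trans Kj; rewrite ler_pM2r// ge_min lexx.
  rewrite mulrDl -[leLHS]add0r lerD// ?(ltW Kr0)//.
  by rewrite mulrAC ler_pdivlMr// ltW.
move=> _ [x wx <-]; apply: contrapT => njx.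
have Ex := cyl_sub attrE wx.
have := hc j _ _ jx0 (fF Ex) njx.
apply/negP; rewrite -ltNge.
have /andP[_ le1] := flip Ex0 Ex; apply: le_lt_trans le1 _.
apply: (@lt_le_trans _ _ (c * (K * rw w))); last by rewrite ler_pM2l.
rewrite /K mulrA mulrCA mulfV ?gt_eqF// mulr1.
apply: (@le_lt_trans _ _ (C * (D * rw w))); first by rewrite ler_pM2l// hD.
by rewrite mulrA ltr_pM2r// ltrDl.
Qed.

(** Points of F close to the image of E_w come from points of E close to E_w,
    and these lie in E_w because of the gap around it. *)
Lemma image_cyl_open : exists2 e, 0 < e & forall w u y,
  tw u <= e * rw w -> cF u y -> (f @` cE w) y -> cF u `<=` f @` cE w.
Proof.
have [c c0 hc] := cyl_gap rho01 simE attrE dustE.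
have [D D0 hD] := cyl_diam tau01 simF attrF.
exists (c / (C * D + C * D)) => [|w u y tue uy [x wx xy] y' uy'].
  by rewrite divr_gt0// addr_gt0// mulr_gt0.
have [x' Ex' x'y'] := f_surj (cyl_sub attrF uy').
exists x' => //; apply: contrapT => nwx'.
have Ex := cyl_sub attrE wx.
have := hc w x x' wx Ex' nwx'; apply/negP; rewrite -ltNge.
have r0 := wweight_gt0 rho01 w.
have /andP[] := flip Ex Ex'; rewrite xy x'y' ler_pdivrMl// => le1 _.
apply: le_lt_trans le1 _.
apply: (@le_lt_trans _ _ (C * (D * tw u))); first by rewrite ler_pM2l// hD.
have CD0 : 0 < C * D by rewrite mulr_gt0.
apply: (@le_lt_trans _ _ (C * (D * (c / (C * D + C * D) * rw w)))).
  by rewrite !ler_pM2l.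
rewrite !mulrA ltr_pM2r// ltr_pdivrMr ?addr_gt0//.
by rewrite [ltLHS]mulrC ltr_pM2l// ltrDl.
Qed.

(** N is chosen such that words of length N contract enough for
    [image_cyl_open] to apply to all cylinders N levels below J w, for the
    images of w and of its children alike. *)
Lemma geometric_coding : exists ins J N a b,
  [/\ 0 < a, 0 < b & coding rho tau ins J N a b].
Proof.
have [a [b [a0 b0 ex_anchor]]] := image_cyl_anchor.
have [J JP] := choice ex_anchor.
have [e e0 he] := image_cyl_open.
have [r0 r00 hr0] := ratio_lb rho01.
have [t1 t101 ht1] := ratio_ub tau01.
have [t10 t11] := andP t101.
have [N hN] : exists N, t1 ^+ N < Num.min e (e * r0) / b.
  by apply: expr_lt_eventually => //; rewrite divr_gt0// lt_min e0 mulr_gt0.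
have {}hN : t1 ^+ N * b <= Num.min e (e * r0) by rewrite ltW// -ltr_pdivlMr.
have small w u : (size (J w) + N <= size u)%N -> (exists v, u = J w ++ v) ->
    tw u <= Num.min e (e * r0) * rw w.
  move=> + [v uE]; rewrite uE size_cat leq_add2l wweight_cat => Nv.
  have [_ /andP[_ Jb]] := JP w.
  apply: (@le_trans _ _ (b * rw w * t1 ^+ N)).
    apply: ler_pM => //; [exact/ltW/wweight_gt0|exact/ltW/wweight_gt0|].
    apply: le_trans (wweight_le_exp tau01 v ht1) _.
    by rewrite ler_wiXn2l// ltW.
  by rewrite mulrC mulrA ler_pM2r ?wweight_gt0.
pose ins w u := `[< cF u `<=` f @` cE w >].
have anchor w u y : (size (J w) <= size u)%N -> cF u y -> (f @` cE w) y ->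
    exists v, u = J w ++ v.
  move=> Ju uy wy; have [/(_ _ wy) Jy _] := JP w.
  exact: (cyl_meet tau01 simF attrF dustF Jy uy Ju).
have sub_child w i : f @` cE (rcons w i) `<=` f @` cE w.
  by apply: image_subset; exact: cyl_rcons_sub.
have deep w u y : (size (J w) + N <= size u)%N -> cF u y -> (f @` cE w) y ->
    ins w u.
  move=> Ju uy wy; apply/asboolP; apply: (he _ _ y) => //.
  apply: le_trans (small w u Ju _) _; last first.
    by rewrite ler_pM2r ?wweight_gt0// ge_min lexx.
  by apply: anchor uy wy; apply: leq_trans Ju; rewrite leq_addr.
have deep_child w i u y : (size (J w) + N <= size u)%N -> cF u y ->
    (f @` cE (rcons w i)) y -> ins (rcons w i) u.
  move=> Ju uy wy; apply/asboolP; apply: (he _ _ y) => //.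
  apply: le_trans (small w u Ju _) _; last first.
    rewrite wweight_rcons [rw w * _]mulrC mulrA ler_pM2r ?wweight_gt0//.
    by rewrite ge_min ler_pM2l// hr0 orbT.
  apply: (anchor _ _ y) => //; first by apply: leq_trans Ju; rewrite leq_addr.
  exact: sub_child wy.
exists ins, J, N, a, b; split => //; split.
- by move=> w; case: (JP w).
- move=> w u v /asboolP uw; apply/asboolP.
  by apply: subset_trans uw; exact: cyl_cat_sub.
- move=> w u Ju /asboolP uw; have [y uy] := cyl_neq0 attrF u.
  by apply: (anchor w u y) => //; exact: uw.
- move=> w u v Ju /asboolP uw; have [y uy] := cyl_neq0 attrF (u ++ v).
  by apply: (deep w u y) => //; [exact: (cyl_cat_sub attrF uy)|exact: uw].
- move=> w i u v Ju /asboolP uw; have [y uy] := cyl_neq0 attrF (u ++ v).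
  by apply: (deep_child w i u y) => //;
    [exact: (cyl_cat_sub attrF uy)|exact: uw].
- move=> w u Ju /asboolP uw; have [y uy] := cyl_neq0 attrF u.
  have [x wx xy] := uw _ uy; have [i wix] := cyl_rcons attrE wx.
  by exists i; apply: (deep_child w i u y) => //; exists x.
- move=> w i u /asboolP uw; apply/asboolP.
  by apply: subset_trans uw _; exact: sub_child.
- move=> w w' u /asboolP uw /asboolP uw' ww'.
  have [y uy] := cyl_neq0 attrF u.
  have [x wx xy] := uw _ uy; have [x' wx' xy'] := uw' _ uy.
  apply: (cyl_inj_weight rho01 simE attrE dustE wx _ ww').
  rewrite (_ : x = x')//; apply: f_inj; last by rewrite xy xy'.
    exact: cyl_sub wx.
  exact: cyl_sub wx'.
- move=> w i i' u /asboolP uw /asboolP uw'.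
  have [y uy] := cyl_neq0 attrF u.
  have [x wx xy] := uw _ uy; have [x' wx' xy'] := uw' _ uy.
  have xx' : x = x'.
    apply: f_inj; last by rewrite xy xy'.
      exact: cyl_sub wx.
    exact: cyl_sub wx'.
  rewrite -xx' in wx'.
  have [|v] := cyl_meet rho01 simE attrE dustE wx wx'.
    by rewrite !size_rcons.
  rewrite -!cats1 -catA => /eqP; rewrite eqseq_cat// eqxx /=.
  by move=> /eqP[].
- move=> w; have [x wx] := cyl_neq0 attrE w.
  have Jx : cF (J w) (f x) by have [Js _] := JP w; exact: (Js _ (imageP f wx)).
  have [v vN Jvx] := cyl_extend attrF N Jx.
  exists v => //; apply: deep Jvx (imageP f wx).
  by rewrite size_cat vN.
Qed.

End geometric_coding.

(** * A bi-Lipschitz map scales measure by a constant somewhere *)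

Lemma wweight_powR (R : realType) (n : nat) (tau : 'I_n -> R) (t : R) u :
  (forall k, 0 <= tau k) ->
  wweight (fun k => tau k `^ t) u = wweight tau u `^ t.
Proof.
move=> tau0; elim: u => [|k u IH]; first by rewrite !wweight_nil powR1.
by rewrite !wweight_cons IH powRM//; exact: prodr_ge0.
Qed.

(** This is what turns almost maximal into maximal in
    [density_locally_constant]. *)
Lemma seq_gap (R : realFieldType) (S : seq R) :
  exists2 h, 1 < h & forall r, r \in S -> 1 < r -> h <= r.
Proof.
elim: S => [|x S [h h1 hS]]; first by exists 2; rewrite ?ltr1n.
have [x1|x1] := leP x 1.
  exists h => // r; rewrite inE => /predU1P[->|]; last exact: hS.
  by rewrite ltNge x1.
exists (Num.min x h) => [|r]; first by rewrite lt_min x1 h1.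
by rewrite inE ge_min => /predU1P[->|/hS rS r1]; rewrite ?lexx// rS ?orbT.
Qed.

Section conformal_measure.
Variables (R : realType) (m n : nat) (rho : 'I_m -> R) (tau : 'I_n -> R).
Variables (ins : seq 'I_m -> seq 'I_n -> bool) (J : seq 'I_m -> seq 'I_n).
Variables (N : nat) (a b t : R).
Hypothesis rho01 : forall j, 0 < rho j < 1.
Hypothesis tau01 : forall j, 0 < tau j < 1.
Hypothesis a0 : 0 < a.
Hypothesis b0 : 0 < b.
Hypothesis cod : coding rho tau ins J N a b.
Hypothesis t0 : 0 <= t.
Hypothesis tau_sum : \sum_k tau k `^ t = 1.

Local Notation rw := (wweight rho).
Local Notation tw := (wweight tau).
Local Notation wt := (fun k => tau k `^ t).

Definition inside (w : seq 'I_m) (u : seq 'I_n) : R := (ins w u)%:R.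

(** The measure of the image of the cylinder of w. *)
Definition mass (w : seq 'I_m) : R := nu wt (size (J w) + N) (inside w).

(** With j = J w, the picture of the image of the cylinder of w rescaled from
    the cylinder of j; it takes finitely many values. *)
Definition shape (w : seq 'I_m) (j : seq 'I_n) : R :=
  nu wt N (fun v => inside w (j ++ v)).
Definition density (w : seq 'I_m) : R := mass w / rw w `^ t.

Let wt_ge0 k : 0 <= wt k. Proof. exact: powR_ge0. Qed.
Let inside_ge0 w u : 0 <= inside w u. Proof. exact: ler0n. Qed.
Let inside_le1 w u : inside w u <= 1. Proof. by rewrite lern1 leq_b1. Qed.
Let rw_gt0 w : 0 < rw w `^ t.
Proof. by rewrite powR_gt0// wweight_gt0. Qed.
Let tau_ge0 k : 0 <= tau k. Proof. by case/andP: (tau01 k) => /ltW. Qed.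
Let rho_ge0 k : 0 <= rho k. Proof. by case/andP: (rho01 k) => /ltW. Qed.
Let rho_gt0 k : 0 < rho k `^ t.
Proof. by rewrite powR_gt0//; case/andP: (rho01 k). Qed.

Let rw_rcons w i : rw (rcons w i) `^ t = rw w `^ t * rho i `^ t.
Proof. by rewrite wweight_rcons powRM// ltW// wweight_gt0. Qed.

(** The image of a child of w is already a union of cylinders at the level
    which is used for w; the two levels are compared through a common
    refinement. *)
Lemma mass_child w i :
  mass (rcons w i) = nu wt (size (J w) + N) (inside (rcons w i)).
Proof.
rewrite /mass -(nu_stable tau_sum (size (J w) + N) (p := inside (rcons w i))).
  rewrite addnC (nu_stable tau_sum)// => u v uN; rewrite /inside.
  congr (nat_of_bool _)%:R; apply/idP/idP; last exact: (coding_cat cod).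
  by apply: (coding_deep_child cod); rewrite uN.
move=> u v uN; rewrite /inside.
congr (nat_of_bool _)%:R; apply/idP/idP; last exact: (coding_cat cod).
by apply: (coding_deep cod); rewrite uN.
Qed.

Lemma mass_sum w : mass w = \sum_i mass (rcons w i).
Proof.
under eq_bigr do rewrite mass_child.
rewrite -nu_sum /mass; apply: eq_nu => u uN.
have Nu : (size (J w) + N <= size u)%N by rewrite uN.
rewrite /inside; have [wu|nwu] := boolP (ins w u); last first.
  rewrite big1// => i _; case: (boolP (ins _ _)) => // /(coding_parent cod).
  by rewrite (negbTE nwu).
have [i wiu] := coding_split cod Nu wu.
rewrite (bigD1 i)//= wiu big1 ?addr0// => k ki.
case: (boolP (ins _ _)) => // /(coding_disjoint cod wiu) ik.
by rewrite ik eqxx in ki.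
Qed.

Lemma mass_shape w : mass w = tw (J w) `^ t * shape w (J w).
Proof.
rewrite -wweight_powR// -(@nu_cat _ _ wt)// => u uN.
rewrite /inside; case: (boolP (ins w u)) => [wu _|]; last by rewrite eqxx.
by apply: (coding_anchor cod _ wu); rewrite uN leq_addr.
Qed.

Lemma mass_child_shape w i :
  mass (rcons w i) = tw (J w) `^ t * shape (rcons w i) (J w).
Proof.
rewrite mass_child -wweight_powR// -(@nu_cat _ _ wt)// => u uN.
rewrite /inside; case: (boolP (ins _ u)) => [wu _|]; last by rewrite eqxx.
by apply: (coding_anchor cod _ (coding_parent cod wu)); rewrite uN leq_addr.
Qed.

(** The upper bound comes from the inclusion of the image in the cylinder of
    J w, the lower bound from the cylinder N levels below that it contains. *)
Lemma density_bounds : exists c1 c2, 0 < c1 /\ forall w,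
  c1 * rw w `^ t <= mass w <= c2 * rw w `^ t.
Proof.
have [r r0 hr] := ratio_lb tau01.
exists (a `^ t * (r ^+ N) `^ t), (b `^ t); split.
  by rewrite mulr_gt0// powR_gt0// exprn_gt0.
move=> w; rewrite mass_shape; have /andP[aw wb] := coding_scale cod w.
have rw0 : 0 <= rw w by rewrite ltW// wweight_gt0.
apply/andP; split; last first.
  rewrite -[leRHS]mulr1 -powRM ?(ltW b0)//; apply: ler_pM => //.
  - exact: powR_ge0.
  - exact: nu_ge0.
  - apply: ge0_ler_powR => //; rewrite nnegrE.
      by rewrite ltW// wweight_gt0.
    by rewrite mulr_ge0 ?(ltW b0).
  - exact: nu_le1.
have [v vN Jv] := coding_ex cod w.
rewrite mulrAC -powRM ?(ltW a0)//; apply: ler_pM => //; try exact: powR_ge0.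
  apply: ge0_ler_powR => //; rewrite nnegrE.
    by rewrite mulr_ge0 ?(ltW a0).
  by rewrite ltW// wweight_gt0.
apply: (@le_trans _ _ (wweight wt v * inside w (J w ++ v))); last first.
  exact: (le_nu wt_ge0 (p := fun v => inside w (J w ++ v))).
rewrite /inside Jv mulr1 wweight_powR//.
apply: ge0_ler_powR => //; rewrite ?nnegrE ?exprn_ge0 ?(ltW r0)//.
  by rewrite ltW// wweight_gt0.
by rewrite -vN wweight_ge_exp// ltW.
Qed.

(** Both attractors have the same dimension: iterating [mass_sum] k times, the
    mass of the whole of F is squeezed between constant multiples of the k-th
    power of the sum. *)
Lemma rho_sum : \sum_i rho i `^ t = 1.
Proof.
have [c1 [c2 [c10 hc]]] := density_bounds.
set sg := \sum_i rho i `^ t.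
have sg0 : 0 <= sg by apply: sumr_ge0 => i _; exact: powR_ge0.
have bnd k w : c1 * rw w `^ t * sg ^+ k <= mass w <= c2 * rw w `^ t * sg ^+ k.
  elim: k w => [|k IH] w; first by rewrite !mulr1.
  have E c : c * rw w `^ t * sg ^+ k.+1 =
      \sum_i c * rw (rcons w i) `^ t * sg ^+ k.
    rewrite exprS mulrA -mulr_suml; congr (_ * _).
    by rewrite mulr_sumr; apply: eq_bigr => i _; rewrite rw_rcons mulrA.
  rewrite !E mass_sum; apply/andP; split; apply: ler_sum => i _;
    by case/andP: (IH (rcons w i)).
have := bnd ^~ [::]; rewrite wweight_nil powR1 => {}bnd.
have m0 : 0 < mass [::].
  by have /andP[+ _] := bnd 0%N; apply: lt_le_trans; rewrite !mulr1.
have c20 : 0 < c2.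
  by have /andP[_] := bnd 0%N; rewrite !mulr1; apply: lt_le_trans.
have sgp : 0 < sg.
  have /andP[_] := bnd 1%N; rewrite expr1 mulr1 => /(lt_le_trans m0).
  by rewrite pmulr_rgt0.
apply/eqP; rewrite eq_le !leNgt; apply/andP; split; apply/negP => s1.
  have s1' : 0 < sg^-1 < 1 by rewrite invr_gt0 sgp invf_lt1.
  have [k hk] := expr_lt_eventually s1' (divr_gt0 c10 m0).
  have /andP[+ _] := bnd k; apply/negP; rewrite -ltNge mulr1.
  move: hk; rewrite ltr_pdivlMr// exprVn mulrC ltr_pdivrMr ?exprn_gt0//.
have s1' : 0 < sg < 1 by rewrite sgp.
have [k hk] := expr_lt_eventually s1' (divr_gt0 m0 c20).
have /andP[_] := bnd k; apply/negP; rewrite -ltNge mulr1.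
by move: hk; rewrite ltr_pdivlMr// mulrC.
Qed.

(** Both masses are measured from the same cylinder J w, whose weight cancels
    in the quotient. *)
Lemma finite_density_ratios : exists S : seq R, forall w i,
  density (rcons w i) / density w \in S.
Proof.
have [S0 hS0] := finite_nu_values wt N.
exists [seq p.1 / p.2 / rho i `^ t |
         p <- [seq (x, y) | x <- S0, y <- S0], i <- enum 'I_m].
move=> w i; apply/allpairsP.
exists ((shape (rcons w i) (J w), shape w (J w)), i) => /=.
split; rewrite ?mem_enum//.
  apply/allpairsP; exists (shape (rcons w i) (J w), shape w (J w)).
  by split => //; exact: hS0.
rewrite /density mass_child_shape mass_shape rw_rcons.
have T0 : tw (J w) `^ t != 0 by rewrite gt_eqF// powR_gt0// wweight_gt0.
have R0 : rw w `^ t != 0 by rewrite gt_eqF.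
have r0 : rho i `^ t != 0 by rewrite gt_eqF.
have [->|s0] := eqVneq (shape w (J w)) 0.
  by rewrite !(mulr0, mul0r, invr0).
by field; rewrite ?s0 ?T0 ?R0 ?r0.
Qed.

Lemma density_sum w : density w = \sum_i rho i `^ t * density (rcons w i).
Proof.
rewrite /density mass_sum mulr_suml; apply: eq_bigr => i _; rewrite rw_rcons.
have R0 : rw w `^ t != 0 by rewrite gt_eqF.
have r0 : rho i `^ t != 0 by rewrite gt_eqF.
by field; rewrite ?r0 ?R0.
Qed.

(** Choose w0 with density within a factor h of the supremum, where h > 1 is a
    lower bound of the density ratios above 1.  Then no descendant can have a
    child of larger density, and as the density is the average over the
    children, all children have the density of their parent. *)
Lemma density_locally_constant : exists w0, 0 < density w0 /\
  forall u, density (w0 ++ u) = density w0.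
Proof.
have [c1 [c2 [c10 hc]]] := density_bounds.
have dge w : c1 <= density w by rewrite ler_pdivlMr//; case/andP: (hc w).
have dle w : density w <= c2 by rewrite ler_pdivrMr//; case/andP: (hc w).
have dgt0 w : 0 < density w by apply: lt_le_trans (dge w).
pose G := sup (range density).
have hs : has_sup (range density).
  by split; [exists (density [::]); exists [::]|exists c2 => _ [w _ <-]].
have leG w : density w <= G by apply: (sup_upper_bound hs); exists w.
have G0 : 0 < G by apply: lt_le_trans (leG [::]).
have [S hS] := finite_density_ratios.
have [h h1 hh] := seq_gap S.
have h0 : 0 < h by apply: lt_trans h1.
have [|_ [w0 _ <-] w0G] := @sup_adherent _ _ (G - G / h) _ hs.
  by rewrite subr_gt0 ltr_pdivrMr// ltr_pMr.
move: w0G; rewrite opprB addrC subrK => w0G.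
exists w0; split => //.
elim/last_ind => [|u i IH]; first by rewrite cats0.
rewrite -rcons_cat -IH; set w := w0 ++ u in IH *.
have ratio_le1 k : density (rcons w k) <= density w.
  rewrite leNgt; apply/negP => lt1.
  have := hh _ (hS w k); rewrite ltr_pdivlMr// mul1r => /(_ lt1).
  rewrite ler_pdivlMr// IH => le2.
  have := le_trans le2 (leG _); rewrite leNgt => /negP; apply.
  by rewrite mulrC -ltr_pdivrMr.
(* The density of w is the average of smaller or equal ones, hence each of
   them equals it. *)
have sum0 : \sum_k rho k `^ t * (density w - density (rcons w k)) = 0.
  under eq_bigr do rewrite mulrBr.
  by rewrite sumrB -density_sum -mulr_suml rho_sum mul1r subrr.
have := psumr_eq0P _ sum0 => /(_ _ i isT)/eqP.
rewrite mulf_eq0 gt_eqF//= subr_eq0 => H.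
apply/esym/eqP/H => k _.
by rewrite mulr_ge0 ?powR_ge0// subr_ge0.
Qed.

(** Below w0 the mass of the image of w is both a constant times rho_w^t and
    tau_(J w)^t times one of finitely many shapes.  The code of w is the last
    part of a cylinder contained in its image; images of distinct words of the
    same weight are disjoint, whence injectivity. *)
Lemma commensurable_coding : exists (J' : seq 'I_m -> seq 'I_n)
    (code : seq 'I_m -> N.-tuple 'I_n) (S : seq R) (a' b' : R),
  [/\ 0 < a', 0 < b',
    forall w, (tw (J' w) / rw w) `^ t \in S,
    forall w, a' * rw w <= tw (J' w) <= b' * rw w &
    forall v w, rw v = rw w -> J' v = J' w -> code v = code w -> v = w].
Proof.
have [w0 [d0 dc]] := density_locally_constant.
have [S0 hS0] := finite_nu_values wt N.
have code_ex w : exists c : N.-tuple 'I_n, ins w (J w ++ c).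
  have [v vN wv] := coding_ex cod w.
  have vN' : size v == N by rewrite vN.
  by exists (Tuple vN').
have [code codeP] := choice code_ex.
have W0 : 0 < rw w0 by rewrite wweight_gt0.
exists (fun w => J (w0 ++ w)), (fun w => code (w0 ++ w)),
  [seq rw w0 `^ t * (density w0 / x) | x <- S0], (a * rw w0), (b * rw w0).
split => [|||w|v w vw Jvw cvw].
- by rewrite mulr_gt0.
- by rewrite mulr_gt0.
- move=> w; apply/mapP.
  exists (shape (w0 ++ w) (J (w0 ++ w))); first exact: hS0.
  have rw0 : 0 < rw w := wweight_gt0 rho01 w.
  have dE := dc w; move: (d0); rewrite -dE /density mass_shape wweight_cat.
  have [->|s0 _] := eqVneq (shape (w0 ++ w) (J (w0 ++ w))) 0.
    by rewrite mulr0 mul0r ltxx.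
  have tw0 : 0 <= tw (J (w0 ++ w)) by rewrite ltW// wweight_gt0.
  rewrite powRM ?invr_ge0 ?(ltW rw0)// powRM ?(ltW rw0) ?(ltW W0)//.
  have -> : (rw w)^-1 `^ t = (rw w `^ t)^-1.
    by rewrite -(powR_inv1 (ltW rw0)) powRAC powR_inv1// powR_ge0.
  have r1 : rw w0 `^ t != 0 by rewrite gt_eqF.
  have r2 : rw w `^ t != 0 by rewrite gt_eqF.
  by field; rewrite ?s0 ?r1 ?r2.
- by have := coding_scale cod (w0 ++ w); rewrite wweight_cat !mulrA.
- have iv := codeP (w0 ++ v); rewrite Jvw cvw in iv.
  have := coding_inj cod iv (codeP (w0 ++ w)).
  rewrite !wweight_cat vw => /(_ erefl)/eqP.
  by rewrite eqseq_cat// eqxx /= => /eqP.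
Qed.

End conformal_measure.

(** * Logarithmic coordinates and pseudo-bases *)

Lemma finite_int_box (R : realType) (s : nat) (c : R) :
  exists B : seq 'rV[int]_s,
    forall x : 'rV[int]_s, (forall i, `|(x ord0 i)%:~R : R| <= c) -> x \in B.
Proof.
pose M := (Num.truncn c).+1.
exists [seq \row_i ((h i : nat)%:Z - M%:Z) | h : {ffun 'I_s -> 'I_(M + M).+1}].
move=> x xc; apply/fintype.imageP.
have xM i : (`|x ord0 i| < M)%N.
  have := le_lt_trans (xc i) (truncnS_gt c).
  by rewrite -intr_norm -[_%:R]/(M%:~R) ltr_int; lia.
exists [ffun i => inord `|(x ord0 i + M%:Z)%R|%N] => //.
apply/rowP => i; rewrite mxE ffunE; move: (xM i); set z := x ord0 i => zM.
by rewrite inordK; lia.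
Qed.

Section logarithmic_coordinates.
Variables (R : realType) (s : nat) (lambda : 'I_s -> R).
Hypothesis lambda0 : forall i, 0 < lambda i.

(** The logarithm of [lpow]: a linear form on the lattice. *)
Definition llog (x : 'rV[int]_s) : R := \sum_i (x ord0 i)%:~R * ln (lambda i).

Lemma lpowE x : lpow lambda x = expR (llog x).
Proof.
rewrite /lpow expR_sum; apply: eq_bigr => i _.
by rewrite -powR_intmul ?ltW// /powR gt_eqF.
Qed.

Lemma llogD x y : llog (x + y) = llog x + llog y.
Proof.
rewrite /llog -big_split; apply: eq_bigr => i _ /=.
by rewrite mxE rmorphD mulrDl.
Qed.

Lemma llogZ c x : llog (c *: x) = c%:~R * llog x.
Proof.
rewrite /llog mulr_sumr; apply: eq_bigr => i _ /=.
by rewrite mxE rmorphM mulrA.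
Qed.

Lemma llog0 : llog 0 = 0.
Proof. by rewrite -(scale0r (0 : 'rV[int]_s)) llogZ mul0r. Qed.

Lemma llogB x y : llog (x - y) = llog x - llog y.
Proof. by rewrite -scaleN1r llogD llogZ mulN1r. Qed.

Lemma llog_sum I (r : seq I) (F : I -> 'rV[int]_s) :
  llog (\sum_(i <- r) F i) = \sum_(i <- r) llog (F i).
Proof. by apply: (big_morph llog); [exact: llogD|exact: llog0]. Qed.

Lemma mgen_sub_lpow : mgen lambda `<=` range (lpow lambda).
Proof.
apply: smallest_sub; first split.
- by move=> _ [x _ <-]; rewrite lpowE expR_gt0.
- by exists 0 => //; rewrite lpowE llog0 expR0.
- move=> _ _ [x _ <-] [y _ <-]; exists (x - y) => //.
  by rewrite !lpowE llogB expRB.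
move=> _ [i _ <-]; exists (delta_mx ord0 i) => //.
rewrite lpowE /llog (bigD1 i)//= big1 ?addr0; last first.
  by move=> j /negbTE ji; rewrite mxE ji andbF mul0r.
by rewrite mxE !eqxx mul1r lnK// posrE.
Qed.

End logarithmic_coordinates.

Lemma mgen_in (R : realType) (m : nat) (rho : 'I_m -> R) j : mgen rho (rho j).
Proof. by apply: sub_gen_smallest; exists j. Qed.

Section pseudo_basis.
Variables (R : realType) (m s : nat) (rho : 'I_m -> R) (lambda : 'I_s -> R).
Hypothesis rho0 : forall j, 0 < rho j.
Hypothesis pb : pseudo_basis rho lambda.

Let lambda0 i : 0 < lambda i. Proof. by case: pb. Qed.

(** A basis b of the group generated by rho is b_i = lambda^(A_i) for an integer
    matrix A, which is nonsingular because b is free; the relation x among the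
    lambda_i is transported to the relation x adj(A) among the b_i. *)
Lemma pseudo_basis_llog_inj x : llog lambda x = 0 -> x = 0.
Proof.
case: pb => _ sub [b [b0 bgen bfree]] x0.
have bl i : exists A : 'rV[int]_s, lpow lambda A = b i.
  have [|A _ AE] := mgen_sub_lpow lambda0 (t := b i); last by exists A.
  by apply: sub; rewrite -bgen; exact: mgen_in.
have [A_ A_E] := choice bl.
pose A : 'M[int]_s := \matrix_(i, j) A_ i ord0 j.
have lnb i : ln (b i) = llog lambda (row i A).
  rewrite -A_E lpowE// expRK; congr llog.
  by apply/rowP => j; rewrite !mxE.
have mulA y : llog lambda (y *m A) = llog b y.
  rewrite mulmx_sum_row llog_sum [RHS]/llog; apply: eq_bigr => i _.
  by rewrite llogZ lnb.
have free y : llog lambda (y *m A) = 0 -> y = 0.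
  by rewrite mulA => y0; apply: bfree; rewrite lpowE// y0 expR0.
have detA : \det A != 0.
  apply/negP => /det0P[v v0 vA]; move/eqP: v0; apply.
  by apply: free; rewrite vA llog0.
have : x *m \adj A = 0.
  by apply: free; rewrite -mulmxA mul_adj_mx mul_mx_scalar llogZ x0 mulr0.
move=> /(congr1 (mulmx^~ A)); rewrite -mulmxA mul_adj_mx mul_mx_scalar mul0mx.
move=> /rowP dx; apply/rowP => i; have := dx i; rewrite !mxE => /eqP.
by rewrite mulf_eq0 (negbTE detA) => /eqP.
Qed.

Lemma lpow_inj : injective (lpow lambda).
Proof.
move=> x y; rewrite !lpowE// => /expR_inj xy; apply/eqP; rewrite -subr_eq0.
by apply/eqP/pseudo_basis_llog_inj; rewrite llogB xy subrr.
Qed.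

Lemma mlogK j : lpow lambda (mlog lambda (rho j)) = rho j.
Proof.
rewrite /mlog; case: xgetP => [x -> //|nx].
case: pb => _ sub _.
have [x _ xE] := mgen_sub_lpow lambda0 (sub _ (@mgen_in _ _ rho j)).
by case: (nx x).
Qed.

Lemma lpowK x : mlog lambda (lpow lambda x) = x.
Proof.
rewrite /mlog; case: xgetP => [y -> /lpow_inj //|nx].
by case: (nx x).
Qed.

Lemma lpow_zkappa w :
  lpow lambda (zkappa (fun j => mlog lambda (rho j)) w) = wweight rho w.
Proof.
elim: w => [|j w IH].
  by rewrite /zkappa big_nil wweight_nil lpowE// llog0 expR0.
rewrite zkappa_cons wweight_cons -IH -{2}(mlogK j).
by rewrite !lpowE// llogD expRD.
Qed.

(** Two powers of the same number always satisfy a nontrivial relation. *)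
Lemma pseudo_basis_rank1 : m = 1%N -> (s <= 1)%N.
Proof.
move=> m1; rewrite leqNgt; apply/negP => s2.
case: pb => _ _ [b [b0 bgen bfree]].
pose j0 : 'I_m := cast_ord (esym m1) ord0.
have lnb i : exists k : int, ln (b i) = k%:~R * ln (rho j0).
  have bi : mgen rho (b i) by rewrite -bgen; exact: mgen_in.
  have [x _ <-] := mgen_sub_lpow rho0 bi; exists (x ord0 j0).
  rewrite lpowE// expRK /llog (bigD1 j0)//= big1 ?addr0// => j.
  case/negP; apply/eqP/val_inj => /=; have := ltn_ord j; rewrite {2}m1; lia.
have [k kE] := choice lnb.
pose i0 : 'I_s := Ordinal (ltnW s2); pose i1 : 'I_s := Ordinal s2.
have i01 : i1 != i0 by [].
have lbd i : llog b (delta_mx ord0 i) = ln (b i).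
  rewrite /llog (bigD1 i)//= big1 ?addr0; last first.
    by move=> j /negbTE ji; rewrite mxE ji andbF mul0r.
  by rewrite mxE !eqxx mul1r.
have free y : llog b y = 0 -> y = 0.
  by move=> y0; apply: bfree; rewrite lpowE// y0 expR0.
have /rowP/(_ i1) :
    k i1 *: delta_mx ord0 i0 - k i0 *: delta_mx ord0 i1 = 0 :> 'rV[int]_s.
  apply: free; rewrite llogB !llogZ !lbd !kE; ring.
rewrite !mxE !eqxx (negbTE i01) andbF mulr0 sub0r mulr1 => /eqP.
rewrite oppr_eq0 => /eqP k0.
have /free/rowP/(_ i0) : llog b (delta_mx ord0 i0) = 0.
  by rewrite lbd kE k0 mul0r.
by rewrite !mxE !eqxx.
Qed.

End pseudo_basis.

(** Intermediate value theorem on [0, d]: the sum is n at t = 0 and less than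
    1 at t = d. *)
Lemma similarity_dimension (R : realType) (d n : nat) (tau : 'I_n -> R) :
  (0 < n)%N -> contraction_vector d tau ->
  exists2 t, 0 <= t & \sum_k tau k `^ t = 1.
Proof.
move=> n0 [tau01 taud]; pose f (t : R) := \sum_k tau k `^ t.
have tau0 k : 0 < tau k by case/andP: (tau01 k).
have cf : continuous f.
  move=> t.
  apply: (@cvg_big R _ +%R 0 xpredT add_continuous _ (nbhs t)) => k _.
  rewrite (_ : powR (tau k) = fun t => expR (t * ln (tau k))); last first.
    by apply/funext => u; rewrite /powR gt_eqF.
  apply: (@continuous_comp _ _ _ (fun t : R => t * ln (tau k)) expR).
    by apply: cvgM; [exact: cvg_id|exact: cvg_cst].
  exact: continuous_expR.
have f0 : 1 <= f 0.
  rewrite /f; under eq_bigr do rewrite powRr0.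
  by rewrite sumr_const card_ord ler1n.
have fd : f d%:R <= 1.
  rewrite /f; apply/ltW; rewrite (eq_bigr (fun k => tau k ^+ d))// => k _.
  by rewrite powR_mulrn// ltW.
have [||t] := @IVT R f 0 d%:R 1 (ler0n _ _).
- exact: continuous_subspaceT.
- by rewrite ge_min fd orbT le_max f0.
by rewrite in_itv /= => /andP[t0 _] ft; exists t.
Qed.

(** * From contraction ratios to lattice vectors *)

(** In rank one a bound on the ratio alone bounds the lattice vector.  This
    serves the case t = 0, where the attractors are single points and the
    measure carries no information. *)
Lemma int_box_of_ratio (R : realType) (s : nat) (lambda : 'I_s -> R) (a b : R) :
  (s <= 1)%N -> (forall i, 0 < lambda i) ->
  (forall x, llog lambda x = 0 -> x = 0) -> 0 < a ->
  exists B : seq 'rV[int]_s, forall x, a <= lpow lambda x <= b -> x \in B.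
Proof.
move=> s1 lambda0 inj a0.
have [B hB] := @finite_int_box R s
  (\sum_i (`|ln a| + `|ln b|) / `|ln (lambda i)|).
exists B => x /andP[ax xb]; apply: hB => i.
have xE : llog lambda x = (x ord0 i)%:~R * ln (lambda i).
  rewrite /llog (bigD1 i)//= big1 ?addr0// => j ji.
  case/negP: ji; apply/eqP/val_inj => /=.
  by have := ltn_ord j; have := ltn_ord i; lia.
have li : ln (lambda i) != 0.
  apply/eqP => l0; have : llog lambda (const_mx 1) = 0.
    rewrite /llog (bigD1 i)//= l0 mulr0 big1 ?addr0// => j ji.
    case/negP: ji; apply/eqP/val_inj => /=.
    by have := ltn_ord j; have := ltn_ord i; lia.
  by move=> /inj/rowP/(_ i); rewrite !mxE.
rewrite (bigD1 i)//= ler_wpDr//.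
  by apply: sumr_ge0 => j _; rewrite divr_ge0// addr_ge0.
rewrite ler_pdivlMr ?normr_gt0// -normrM -xE.
have p0 : 0 < lpow lambda x by apply: lt_le_trans ax.
have {}ax : ln a <= llog lambda x.
  by rewrite -[llog _ _]expRK -lpowE// ler_ln ?posrE.
have {}xb : llog lambda x <= ln b.
  rewrite -[llog _ _]expRK -lpowE// ler_ln ?posrE//.
  exact: lt_le_trans xb.
have := ler_norm (- ln a); have := ler_norm (ln b); rewrite normrN => na nb.
have := normr_ge0 (ln a); have := normr_ge0 (ln b) => nb0 na0.
by rewrite ler_norml; apply/andP; split; lra.
Qed.

(** The logarithm in the pseudo-basis turns the finitely many ratios of
    [commensurable_coding] into finitely many lattice vectors, since
    tau_(J w) / rho_w is [lpow] of the difference of the values. *)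
Lemma lattice_coding (R : realType) (d m n s : nat)
    (rho : 'I_m -> R) (tau : 'I_n -> R) (lambda : 'I_s -> R) :
  contraction_vector d rho -> contraction_vector d tau ->
  dust_like_equiv d rho tau ->
  pseudo_basis rho lambda -> pseudo_basis tau lambda ->
  exists (J : seq 'I_m -> seq 'I_n) (T : finType) (code : seq 'I_m -> T)
    (B : seq 'rV[int]_s),
    (forall w, zkappa (fun k => mlog lambda (tau k)) (J w) -
               zkappa (fun j => mlog lambda (rho j)) w \in B) /\
    (forall v w, zkappa (fun j => mlog lambda (rho j)) v =
                 zkappa (fun j => mlog lambda (rho j)) w ->
       J v = J w -> code v = code w -> v = w).
Proof.
move=> hrho htau [E [F [[phi [simE attrE dustE]] [psi [simF attrF dustF]]
  [f [C [fbij C0 flip]]]]]] pbr pbt.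
have rho01 := hrho.1; have tau01 := htau.1.
have rho0 j : 0 < rho j by case/andP: (rho01 j).
have tau0 j : 0 < tau j by case/andP: (tau01 j).
have lambda0 i : 0 < lambda i by case: pbr.
have n0 : (0 < n)%N.
  have [[x]] := attrF; move=> + _ FE; rewrite FE => -[[k kn] _ _].
  exact: leq_ltn_trans kn.
have [t t0 tsum] := similarity_dimension n0 htau.
have [ins [J [N [a [b [a0 b0 cod]]]]]] :=
  geometric_coding rho01 simE attrE dustE tau01 simF attrF dustF fbij C0 flip.
have rsum := rho_sum rho01 tau01 a0 b0 cod t0 tsum.
have [J' [code [S [a' [b' [a'0 b'0 JS Jab Jinj]]]]]] :=
  commensurable_coding rho01 tau01 a0 b0 cod t0 tsum.
set X := fun j => mlog lambda (rho j); set Y := fun k => mlog lambda (tau k).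
have ratioE w : lpow lambda (zkappa Y (J' w) - zkappa X w) =
    wweight tau (J' w) / wweight rho w.
  rewrite -(lpow_zkappa pbt) -(lpow_zkappa pbr).
  by rewrite !lpowE// llogB expRB.
have inj v w : zkappa X v = zkappa X w -> J' v = J' w ->
    code v = code w -> v = w.
  move=> vw; apply: Jinj.
  by rewrite -(lpow_zkappa pbr) -(lpow_zkappa pbr) -/X vw.
(* If t = 0 then m = 1 and the powers with exponent t are all 1. *)
have [t_eq0|tn0] := eqVneq t 0.
  have m1 : m = 1%N.
    have := rsum; rewrite t_eq0; under eq_bigr do rewrite powRr0.
    by rewrite sumr_const card_ord => /eqP; rewrite (eqr_nat R m 1) => /eqP.
  have [B hB] := int_box_of_ratio b' (pseudo_basis_rank1 rho0 pbr m1) lambda0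
    (pseudo_basis_llog_inj pbr) a'0.
  exists J', _, code, B; split => // w; apply: hB; rewrite ratioE.
  have w0 := wweight_gt0 rho01 w.
  by rewrite ler_pdivlMr// ler_pdivrMr.
exists J', _, code, [seq mlog lambda (x `^ t^-1) | x <- S]; split => // w.
apply/mapP; exists ((wweight tau (J' w) / wweight rho w) `^ t); first exact: JS.
have q0 : 0 < wweight tau (J' w) / wweight rho w.
  by rewrite divr_gt0// wweight_gt0.
rewrite -powRrM mulfV// powRr1 ?ltW// -ratioE.
by rewrite (lpowK pbr).
Qed.

(** * Cones and nearest lattice points *)

Section real_vectors.
Variables (R : realType) (s : nat).

Lemma real_vecD (x y : 'rV[int]_s) :
  real_vec R (x + y) = real_vec R x + real_vec R y.
Proof. exact: map_mxD. Qed.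

Lemma real_vec0 : real_vec R (0 : 'rV[int]_s) = 0.
Proof. exact: map_mx0. Qed.

Lemma real_vec_sum I (r : seq I) (F : I -> 'rV[int]_s) :
  real_vec R (\sum_(i <- r) F i) = \sum_(i <- r) real_vec R (F i).
Proof. by apply: (big_morph (@real_vec R s) real_vecD real_vec0). Qed.

Lemma real_vecMn (x : 'rV[int]_s) k : real_vec R (x *+ k) = real_vec R x *+ k.
Proof.
by elim: k => [|k IH]; rewrite ?mulr0n ?real_vec0// !mulrS real_vecD IH.
Qed.

Lemma real_vec_inj : injective (@real_vec R s).
Proof.
move=> x y /rowP xy; apply/rowP => i.
by have := xy i; rewrite !mxE => /intr_inj.
Qed.

End real_vectors.

Section cone_transfer.
Variables (R : realType) (s m n : nat).
Variables (X : 'I_m -> 'rV[int]_s) (Y : 'I_n -> 'rV[int]_s).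
Variables (J : seq 'I_m -> seq 'I_n) (B : seq 'rV[int]_s).
Hypothesis JB : forall w, zkappa Y (J w) - zkappa X w \in B.

(** The word j^L is sent by J to a word whose value is L X_j up to an error
    b in B.  By Dickson's lemma this relation dominates a relation with the same
    error b and a number of letters j less than L; subtracting the two removes
    the error. *)
Lemma multiple_in_semigroup j : exists (N : nat) (c : 'I_n -> nat),
  (0 < N)%N /\ X j *+ N = \sum_k Y k *+ c k.
Proof.
have dk b := @dickson (option 'I_n) (fun c =>
    \sum_k Y k *+ c (Some k) - X j *+ c None = b).
have [M MP] := choice dk.
(* Longer than all the numbers of letters j allowed by the bounds M b. *)
pose L := (\max_(b <- B) M b).+1.
pose w := nseq L j.
have wE : zkappa X w = X j *+ L.
  rewrite /w; elim: (L) => [|k IH] /=; first by rewrite /zkappa big_nil.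
  by rewrite zkappa_cons IH mulrS.
pose c (o : option 'I_n) := if o is Some k then count_mem k (J w) else L.
have [|e [eb ec eM]] := MP (zkappa Y (J w) - zkappa X w) c.
  by rewrite wE zkappa_count.
have eL : (e None < L)%N.
  rewrite ltnS (leq_trans (eM None))//.
  by apply: leq_bigmax_seq (JB w) _.
exists (L - e None)%N, (fun k => c (Some k) - e (Some k))%N.
split; first by rewrite subn_gt0.
under eq_bigr => k _ do rewrite mulrnBr ?ec//.
rewrite sumrB mulrnBr; last exact: ltnW.
have YE : \sum_k Y k *+ c (Some k) = zkappa Y (J w) by rewrite zkappa_count.
rewrite YE; apply/eqP; rewrite subr_eq addrAC -addrA -(opprB _ (X j *+ e None)).
by rewrite eb wE opprB addrC subrK.
Qed.

Lemma cone_sub : (cone X : set 'rV[R]_s) `<=` cone Y.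
Proof.
have [N NP] := choice multiple_in_semigroup.
have [c cP] := choice NP.
have XE j : real_vec R (X j) =
    \sum_k ((c j k)%:R / (N j)%:R) *: real_vec R (Y k).
  have [N0 NE] := cP j.
  have Nn0 : (N j)%:R != 0 :> R by rewrite pnatr_eq0 -lt0n.
  apply: (scalerI Nn0).
  rewrite scaler_nat -real_vecMn NE real_vec_sum scaler_sumr.
  apply: eq_bigr => k _; rewrite real_vecMn scalerA mulrCA mulfV// mulr1.
  by rewrite scaler_nat.
move=> _ [t t0 ->].
exists (fun k => \sum_j t j * ((c j k)%:R / (N j)%:R)) => [k|].
  by apply: sumr_ge0 => j _; rewrite mulr_ge0// divr_ge0.
under eq_bigr => j _ do rewrite XE scaler_sumr.
rewrite exchange_big; apply: eq_bigr => k _ /=.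
by rewrite scaler_suml; apply: eq_bigr => j _; rewrite scalerA.
Qed.

End cone_transfer.

Definition l1norm (s : nat) (z : 'rV[int]_s) : nat := \sum_i `|z ord0 i|%N.

(** The form taken by the half-space condition: the inner product with alpha
    is at least a positive constant on each letter. *)
Definition linear_length (s m : nat) (X : 'I_m -> 'rV[int]_s) (C : nat) :
    Prop :=
  forall w, (size w <= C * l1norm (zkappa X w))%N.

(** The linear form - llog is bounded below by a positive constant on each
    vector log rho_j. *)
Lemma linear_length_mlog (R : realType) (m s : nat) (rho : 'I_m -> R)
    (lambda : 'I_s -> R) :
  (forall j, 0 < rho j < 1) -> pseudo_basis rho lambda ->
  exists C, linear_length (fun j => mlog lambda (rho j)) C.
Proof.
move=> rho01 pb; have lambda0 i : 0 < lambda i by case: pb.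
have rho0 j : 0 < rho j by case/andP: (rho01 j).
have [a a0 ha] : exists2 a : R, 0 < a & forall j, a <= - ln (rho j).
  apply: fin_pos_lb => j; rewrite oppr_gt0 ln_lt0//.
pose K := \sum_i `|ln (lambda i)|.
have K0 : 0 <= K by apply: sumr_ge0.
pose C := (Num.truncn (K / a)).+1.
exists C => w; set z := zkappa _ w.
have aw : a * (size w)%:R <= - llog lambda z.
  have -> : llog lambda z = ln (wweight rho w).
    by rewrite -(lpow_zkappa pb) lpowE// expRK.
  elim: w {z} => [|j w IH]; first by rewrite wweight_nil ln1 mulr0 oppr0.
  rewrite wweight_cons lnM ?posrE ?wweight_gt0// opprD /= -natr1 mulrDr mulr1.
  rewrite addrC.
  exact: lerD.
have zK : - llog lambda z <= (l1norm z)%:R * K.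
  rewrite (le_trans (ler_norm _))// normrN (le_trans (ler_norm_sum _ _ _))//.
  rewrite mulr_sumr; apply: ler_sum => i _; rewrite normrM ler_wpM2r//.
  rewrite -intr_norm -[leRHS]/((Posz (l1norm z))%:~R) ler_int.
  rewrite /l1norm (bigD1 i)//=; lia.
rewrite -(ler_nat R) -(ler_pM2l a0) (le_trans aw)// (le_trans zK)//.
rewrite natrM mulrA [leLHS]mulrC ler_wpM2r// -ler_pdivrMl// mulrC.
exact/ltW/truncnS_gt.
Qed.

Lemma linear_length_words s m (X : 'I_m -> 'rV[int]_s) C z :
  linear_length X C -> words_leq X z (C * l1norm z).
Proof. by move=> XC w <-. Qed.

Section nearest_points.
Variables (R : realType) (s m : nat) (X : 'I_m -> 'rV[int]_s).

Lemma kappa_real_vec w : kappa R X w = real_vec R (zkappa X w).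
Proof. by rewrite /kappa real_vec_sum. Qed.

Lemma word_mult_real_vec z : word_mult X (real_vec R z) = nwords X z.
Proof.
rewrite /word_mult /nwords; congr #|` fset_set _|.
apply/seteqP; split => w /=; rewrite kappa_real_vec; first exact: real_vec_inj.
by move=> ->.
Qed.

Lemma lattice_coneP x :
  lattice_cone X x <-> exists w, x = real_vec R (zkappa X w).
Proof.
split=> [[k ->]|[w ->]].
  exists (vword k); rewrite zkappa_vword real_vec_sum.
  by apply: eq_bigr => j _; rewrite real_vecMn.
exists (fun j => count_mem j w); rewrite zkappa_count real_vec_sum.
by apply: eq_bigr => j _; rewrite real_vecMn.
Qed.

Lemma seq_argmin (T : eqType) (f : T -> R) (P : T -> Prop) (r : seq T) :
  (exists2 x, x \in r & P x) ->
  exists x, [/\ x \in r, P x & forall y, y \in r -> P y -> f x <= f y].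
Proof.
elim: r => [[]//|a r IH] [x xr Px].
have [/IH[y [yr Py ymin]]|nor] := pselect (exists2 x, x \in r & P x);
    last first.
  have ax : x = a.
    by move: xr; rewrite inE => /predU1P[//|xr]; case: nor; exists x.
  exists x; split => // y.
  rewrite inE => /predU1P[->|yr Py]; first by rewrite ax.
  by case: nor; exists y.
have [[Pa fa]|na] := pselect (P a /\ f a <= f y).
  exists a; rewrite inE eqxx; split => // u.
  rewrite inE => /predU1P[->//|ur Pu].
  by rewrite (le_trans fa)// ymin.
exists y; rewrite inE yr orbT; split => // u.
rewrite inE => /predU1P[-> Pa|]; last exact: ymin.
by rewrite leNgt; apply/negP => lt1; apply: na; split => //; exact: ltW.
Qed.

(** Only finitely many integer vectors are as close to x as the value of
    w0. *)
Lemma nearest_lattice_point (x : 'rV[R]_s) (w0 : seq 'I_m) : exists w,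
  forall w', enorm (x - real_vec R (zkappa X w)) <=
             enorm (x - real_vec R (zkappa X w')).
Proof.
pose dist z := enorm (x - real_vec R z).
pose r := dist (zkappa X w0).
have [B hB] := @finite_int_box R s (r + \sum_i `|x ord0 i|).
have near z : dist z <= r -> z \in B.
  move=> zr; apply: hB => i.
  have := le_trans (coord_le_enorm _ i) zr; rewrite !mxE => xz.
  rewrite -[(z _ _)%:~R](subKr (x ord0 i)) (le_trans (ler_normB _ _))//.
  by rewrite addrC lerD// (bigD1 i)//= lerDl sumr_ge0.
have [|z [zB [w wz] zmin]] :=
    @seq_argmin _ dist (fun z => exists w, z = zkappa X w) B.
  by exists (zkappa X w0); [exact: near|exists w0].
exists w => w'; rewrite -wz -!/(dist _).
have [w'r|rw'] := leP (dist (zkappa X w')) r.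
  by apply: zmin; [exact: near|exists w'].
apply: le_trans (ltW rw'); apply: zmin; [exact: near|by exists w0].
Qed.

(** Both cases in the definition of [mult] amount to choosing a nearest point
    of the semigroup. *)
Lemma mult_nearest (x : 'rV[R]_s) w0 r :
  enorm (x - real_vec R (zkappa X w0)) <= r ->
  exists w, mult X x = nwords X (zkappa X w) /\
    enorm (x - real_vec R (zkappa X w)) <= r.
Proof.
move=> w0r; rewrite /mult; case: asboolP => [/lattice_coneP[w xE]|nx].
  exists w; rewrite xE word_mult_real_vec subrr; split => //.
  rewrite /enorm big1 ?sqrtr0 => [|i _]; last by rewrite mxE expr0n.
  exact: le_trans (enorm_ge0 _) w0r.
have [w wmin] := nearest_lattice_point x w0.
have dE : dist_lattice X x = enorm (x - real_vec R (zkappa X w)).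
  rewrite /dist_lattice /set_min.
  case: xgetP => [y _ [[_ /lattice_coneP[v ->] <-] lb]|nn].
    apply/le_anti; rewrite wmin andbT; apply: lb.
    by exists (real_vec R (zkappa X w)) => //; apply/lattice_coneP; exists w.
  case: (nn (enorm (x - real_vec R (zkappa X w)))); split.
    by exists (real_vec R (zkappa X w)) => //; apply/lattice_coneP; exists w.
  by move=> _ [_ /lattice_coneP[v ->] <-].
rewrite /set_min; case: xgetP => [y _ [[_ [/lattice_coneP[v ->] vd] <-] _]|nn].
  exists v; rewrite word_mult_real_vec; split => //.
  by rewrite vd dE (le_trans (wmin w0)).
exfalso.
set A := [set word_mult X z | z in _] in nn.
have Aex : exists k, `[< A k >].
  exists (word_mult X (real_vec R (zkappa X w))); apply/asboolP.
  exists (real_vec R (zkappa X w)) => //; split; last by rewrite dE.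
  by apply/lattice_coneP; exists w.
case: (ex_minnP Aex) => k /asboolP Ak kmin.
by apply: (nn k); split => // j Aj; rewrite leEnat; apply: kmin; apply/asboolP.
Qed.

(** Round the coefficients of k theta down to integers. *)
Lemma cone_near_lattice theta : cone X theta -> exists r, forall k : nat,
  exists w, enorm (k%:R *: theta - real_vec R (zkappa X w)) <= r.
Proof.
move=> [t t0 thE].
exists (\sum_i \sum_j `|(X j ord0 i)%:~R|) => k.
exists (vword (fun j => Num.truncn (k%:R * t j))).
apply: le_trans (enorm_le_sum _) _; apply: ler_sum => i _.
rewrite zkappa_vword real_vec_sum thE scaler_sumr -sumrB summxE.
apply: le_trans (ler_norm_sum _ _ _) _; apply: ler_sum => j _.
rewrite real_vecMn -(scaler_nat (Num.truncn _)) scalerA -scalerBl !mxE normrM.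
have kt0 : 0 <= k%:R * t j by rewrite mulr_ge0.
rewrite ler_piMl// ger0_norm; last by rewrite subr_ge0 truncn_le.
by rewrite lerBlDr (le_trans (ltW (truncnS_gt _)))// -natr1 addrC.
Qed.

End nearest_points.

(** * Comparison of the growth functions *)

Lemma l1normD s (x y : 'rV[int]_s) : (l1norm (x + y) <= l1norm x + l1norm y)%N.
Proof.
rewrite /l1norm -big_split; apply: leq_sum => i _ /=; rewrite mxE.
by move: (x ord0 i) (y ord0 i) => a b; lia.
Qed.

Lemma l1norm_near (R : realType) s (theta : 'rV[R]_s) (z : 'rV[int]_s)
    (k : nat) (r : R) :
  enorm theta = 1 -> enorm (k%:R *: theta - real_vec R z) <= r ->
  (l1norm z <= s * (k + (Num.truncn r).+1))%N.
Proof.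
move=> th1 zr; rewrite /l1norm -[X in (X * _)%N]card_ord -sum_nat_const.
apply: leq_sum => i _; rewrite -(ler_nat R) natrD.
have := le_trans (coord_le_enorm _ i) zr; rewrite !mxE => xz.
have ti : `|k%:R * theta ord0 i| <= k%:R.
  by rewrite normrM ger0_norm// ler_piMr// -th1 coord_le_enorm.
rewrite -[leLHS]/(Posz `|z ord0 i|%N)%:~R abszE intr_norm.
rewrite -[(z _ _)%:~R](subKr (k%:R * theta ord0 i)).
rewrite (le_trans (ler_normB _ _))//.
by rewrite lerD// (le_trans xz)// ltW// truncnS_gt.
Qed.

(** A word of value z is determined by its image under J, whose value is
    z + b for some b in B, together with the index of b and the code. *)
Lemma nwords_transfer (s m n : nat) (X : 'I_m -> 'rV[int]_s)
    (Y : 'I_n -> 'rV[int]_s) (J : seq 'I_m -> seq 'I_n) (T : finType)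
    (code : seq 'I_m -> T) (B : seq 'rV[int]_s) (z : 'rV[int]_s) (L M : nat) :
  (forall w, zkappa Y (J w) - zkappa X w \in B) ->
  (forall v w, zkappa X v = zkappa X w ->
     J v = J w -> code v = code w -> v = w) ->
  words_leq X z L ->
  (forall b, b \in B -> exists L', words_leq Y (z + b) L') ->
  (forall b, b \in B -> (nwords Y (z + b) <= M)%N) ->
  (nwords X z <= #|{: 'I_(size B).+1 * T}| * M)%N.
Proof.
move=> JB Jinj zL YL YM.
pose off w := zkappa Y (J w) - zkappa X w.
have indexB w : (index (off w) B < (size B).+1)%N by rewrite ltnS index_size.
have fin := finite_words_leq zL.
apply: (leq_card_fset_set_fibers
  (g := fun w => (inord (index (off w) B) : 'I_(size B).+1, code w))) => //.
move=> [p c].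
have [pB|pB] := ltnP p (size B); last first.
  rewrite (_ : _ `&` _ = set0) ?fset_set0// -subset0 => w [_ /= [pE _]].
  have := JB w; rewrite -index_mem -/(off w) -(inordK (indexB w)) pE.
  by rewrite ltnNge pB.
set b := nth 0 B p.
have bB : b \in B by apply: mem_nth.
apply: leq_trans (YM b bB); have [L' zL'] := YL b bB.
have offE w : (inord (index (off w) B) : 'I_(size B).+1) = p -> off w = b.
  by move=> pE; rewrite /b -pE inordK// nth_index//; exact: JB.
apply: (@leq_card_fset_set_inj _ _ _ _ J).
- by apply: sub_finite_set fin => w [].
- exact: finite_words_leq zL'.
- by move=> w /= [wz [/offE <- _]]; rewrite /off -wz addrC subrK.
- move=> v w /= [vz [_ cv]] [wz [_ cw]] Jvw.
  by apply: Jinj => //; [rewrite vz wz|rewrite cv cw].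
Qed.

(** The nearest points of the two semigroups to k theta are at bounded
    distance from each other and of size O(k), so the polynomial factor in
    [nwords_comparable] is polynomial in k, uniformly. *)
Lemma mult_compare (R : realType) (s m n : nat) (X : 'I_m -> 'rV[int]_s)
    (Y : 'I_n -> 'rV[int]_s) (J : seq 'I_m -> seq 'I_n) (T : finType)
    (code : seq 'I_m -> T) (B : seq 'rV[int]_s) (CX CY : nat)
    (theta : 'rV[R]_s) :
  (forall w, zkappa Y (J w) - zkappa X w \in B) ->
  (forall v w, zkappa X v = zkappa X w ->
     J v = J w -> code v = code w -> v = w) ->
  linear_length X CX -> linear_length Y CY ->
  enorm theta = 1 -> cone X theta -> cone Y theta ->
  exists K E, forall k : nat,
    (mult X (k%:R *: theta) <= K * k.+1 ^ E * mult Y (k%:R *: theta))%N.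
Proof.
move=> JB Jinj lX lY th1 thX thY.
have [rX hX] := cone_near_lattice thX; have [rY hY] := cone_near_lattice thY.
have [B0 hB0] := @finite_int_box R s (rX + rY).
pose B1 := [seq b + x | b <- B, x <- B0].
have [K [E KE]] := nwords_comparable Y B1.
(* D is such that D (k+1) exceeds the length of all words involved. *)
pose beta := (\max_(b <- B) l1norm b)%N.
pose D := (CY * (s + s * (Num.truncn rX).+1 + beta)).+1.
exists (#|{: 'I_(size B).+1 * T}| * (K * D ^ E))%N, E => k.
have [wX0 /mult_nearest[wX [-> rX1]]] := hX k.
have [wY0 /mult_nearest[wY [-> rY1]]] := hY k.
set z := zkappa X wX in rX1 *; set z' := zkappa Y wY in rY1 *.
have zz' : z - z' \in B0.
  apply: hB0 => i.
  have := le_trans (coord_le_enorm _ i) rX1.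
  have := le_trans (coord_le_enorm _ i) rY1; rewrite !mxE => yi xi.
  rewrite rmorphB /= (_ : _ - _ = (k%:R * theta ord0 i - (z' ord0 i)%:~R) -
     (k%:R * theta ord0 i - (z ord0 i)%:~R)); last by ring.
  by rewrite (le_trans (ler_normB _ _))// addrC lerD.
have zl := l1norm_near th1 rX1.
have lYz b : b \in B -> words_leq Y (z + b) (D * k.+1).-1.
  move=> bB w wz; rewrite (leq_trans (lY w))// wz.
  have bb : (l1norm b <= beta)%N by apply: leq_bigmax_seq.
  have zb := l1normD z b.
  have {zb}zb : (l1norm (z + b)%R <= s * (k + (Num.truncn rX).+1) + beta)%N.
    by rewrite (leq_trans zb)// leq_add.
  rewrite (leq_trans (leq_mul (leqnn CY) zb))// /D.
  set q := (Num.truncn rX).+1; rewrite mulSn; nia.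
have := @nwords_transfer _ _ _ X Y J T code B z _
  (K * (D * k.+1) ^ E * nwords Y z') JB Jinj (linear_length_words (z := z) lX).
rewrite expnMn !mulnA; apply.
  by move=> b bB; exists (D * k.+1).-1; exact: lYz.
move=> b bB.
have bz : z + b - z' \in B1.
  by apply/allpairsP; exists (b, z - z'); split => //=; rewrite addrCA addrA.
have := KE (z + b) wY _ _ bz (lYz b bB) (linear_length_words (z := z') lY).
by rewrite prednK ?expnMn ?mulnA// muln_gt0.
Qed.

Lemma mult_gt0 (R : realType) (s m : nat) (X : 'I_m -> 'rV[int]_s) (C : nat)
    (theta : 'rV[R]_s) k :
  linear_length X C -> cone X theta -> (0 < mult X (k%:R *: theta))%N.
Proof.
move=> lX thX; have [r hr] := cone_near_lattice thX.
have [w0 /mult_nearest[w [-> _]]] := hr k.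
have fin := finite_words_leq (linear_length_words (z := zkappa X w) lX).
rewrite /nwords cardfs_gt0; apply/fset0Pn; exists w.
by rewrite in_fset_set// inE.
Qed.

Lemma cvg_inv_sqrt (R : realType) (c : R) :
  c / Num.sqrt k.+1%:R @[k --> \oo] --> 0.
Proof.
rewrite -[X in _ --> X](mulr0 c); apply: cvgM; first exact: cvg_cst.
rewrite (_ : (fun k => _) = (fun k => Num.sqrt (@harmonic R k))); last first.
  by apply/funext => k; rewrite /harmonic sqrtrV.
rewrite -[X in _ --> X](@sqrtr0 R).
apply: continuous_cvg; first exact: sqrt_continuous.
exact: cvg_harmonic.
Qed.

(** ln (k+1) <= 2 sqrt (k+1), and (k+1) / k <= 2 for k >= 1; for k = 0 both
    quotients are 0. *)
Lemma growth_le_bound (R : realType) (K E k a b : nat) :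
  (0 < a)%N -> (0 < b)%N -> (a <= K * k.+1 ^ E * b)%N ->
  ln (a%:R : R) / k%:R - ln b%:R / k%:R <=
    (2 * (`|ln (K%:R : R)| + E%:R * 2)) / Num.sqrt k.+1%:R.
Proof.
move=> a0 b0 ab.
have K0 : (0 < K)%N by case: K ab => //; rewrite !mul0n; lia.
have q0 : 0 < Num.sqrt k.+1%:R :> R by rewrite sqrtr_gt0.
case: k ab q0 => [|k] ab q0.
  by rewrite invr0 !mulr0 subrr divr_ge0 ?sqrtr_ge0// mulr_ge0// addr_ge0//
    mulr_ge0.
set q := Num.sqrt _ in q0 *.
have qq : q ^+ 2 = k.+2%:R by rewrite sqr_sqrtr.
have q1 : 1 <= q by rewrite -(@sqrtr1 R) ler_wsqrtr// ler1n.
have lnq : ln (k.+2%:R : R) <= 2 * q.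
  rewrite -qq lnXn//.
  have : ln q <= q.
    by have := @le_ln1Dx R (q - 1); rewrite [1 + _]addrC subrK; lra.
  rewrite mulr2n; lra.
have lnab : ln (a%:R : R) <= ln K%:R + E%:R * ln k.+2%:R + ln b%:R.
  rewrite mulr_natl -lnXn// -lnM ?posrE ?exprn_gt0 ?ltr0n//.
  rewrite -lnM ?posrE ?mulr_gt0 ?exprn_gt0 ?ltr0n//.
  rewrite ler_ln ?posrE ?mulr_gt0 ?exprn_gt0 ?ltr0n//.
  by rewrite -natrX -!natrM ler_nat.
rewrite -mulrBl ler_pdivrMr ?ltr0n// mulrAC ler_pdivlMr//.
have lnKq : ln (K%:R : R) <= `|ln (K%:R : R)| * q.
  by rewrite (le_trans (ler_norm _))// ler_peMr.
have d1 : ln (a%:R : R) - ln b%:R <= (`|ln (K%:R : R)| + E%:R * 2) * q.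
  have E0 : 0 <= E%:R :> R by [].
  have := ler_wpM2l E0 lnq; move: lnab lnKq; clearbody q; lra.
apply: (le_trans (ler_wpM2r (ltW q0) d1)).
have c0 : 0 <= `|ln (K%:R : R)| + E%:R * 2 by rewrite addr_ge0 ?mulr_ge0.
have k2 : (k.+2%:R : R) <= 2 * k.+1%:R by rewrite -natrM ler_nat; lia.
by rewrite -mulrA -expr2 qq (le_trans (ler_wpM2l c0 k2))// mulrA [2 * _]mulrC.
Qed.

(** The difference of the two sequences tends to 0, so they have the same
    limits, or none; this suffices for the two values of [limn] to coincide. *)
Lemma growth_eq (R : realType) (a b : nat -> nat) (K K' E E' : nat) :
  (forall k, (0 < a k)%N) -> (forall k, (0 < b k)%N) ->
  (forall k, (a k <= K * k.+1 ^ E * b k)%N) ->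
  (forall k, (b k <= K' * k.+1 ^ E' * a k)%N) ->
  limn (fun k : nat => ln (a k)%:R / k%:R : R) =
  limn (fun k : nat => ln (b k)%:R / k%:R : R).
Proof.
move=> a0 b0 ab ba.
pose u (p : nat -> nat) k : R := ln (p k)%:R / k%:R.
have diff0 (p q : nat -> nat) L L' F F' :
    (forall k, (0 < p k)%N) -> (forall k, (0 < q k)%N) ->
    (forall k, (p k <= L * k.+1 ^ F * q k)%N) ->
    (forall k, (q k <= L' * k.+1 ^ F' * p k)%N) ->
    u p k - u q k @[k --> \oo] --> 0.
  move=> p0 q0 pq qp.
  pose c : R := 2 * (`|ln (L%:R : R)| + F%:R * 2).
  pose c' : R := 2 * (`|ln (L'%:R : R)| + F'%:R * 2).
  apply: (@squeeze_cvgr _ _ _ _ (fun k => (- c') / Num.sqrt k.+1%:R)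
    (fun k => c / Num.sqrt k.+1%:R)); [|exact: cvg_inv_sqrt..].
  apply: nearW => k; rewrite growth_le_bound// andbT.
  by rewrite mulNr lerNl opprB growth_le_bound.
have sub (p q : nat -> nat) (l : R) : u p k - u q k @[k --> \oo] --> 0 ->
    u q k @[k --> \oo] --> l -> u p k @[k --> \oo] --> l.
  move=> h1 h2; rewrite -(add0r l) (_ : u p = fun k => (u p k - u q k) + u q k).
    exact: cvgD.
  by apply/funext => k; rewrite subrK.
congr (get _); apply/funext => l; apply/propext; split.
  by apply: sub; apply: diff0 ba ab.
by apply: sub; apply: diff0 ab ba.
Qed.

Lemma dust_like_equiv_sym (R : realType) (d m n : nat)
    (rho : 'I_m -> R) (tau : 'I_n -> R) :
  dust_like_equiv d rho tau -> dust_like_equiv d tau rho.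
Proof.
move=> [E [F [hE hF [f [C [[fS fI fJ] C0 hf]]]]]]; exists F, E; split => //.
have gex y : exists x, F y -> E x /\ f x = y.
  have [Fy|nFy] := pselect (F y); last by exists 0.
  by have [x Ex xy] := fJ y Fy; exists x.
have [g gP] := choice gex.
exists g, C; split => //; first split.
- by move=> y Fy; have [] := gP y Fy.
- move=> y y'; rewrite !inE => Fy Fy' yy'.
  by have [_ <-] := gP y Fy; have [_ <-] := gP y' Fy'; rewrite yy'.
- move=> x Ex; have Ffx : F (f x) by exact: fS.
  exists (f x) => //; have [Egx gx] := gP _ Ffx.
  by apply: fI; rewrite ?inE.
move=> y y' Fy Fy'; have [Eg gy] := gP y Fy; have [Eg' gy'] := gP y' Fy'.
have /andP[h1 h2] := hf _ _ Eg Eg'; rewrite gy gy' in h1 h2.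
by rewrite ler_pdivrMl// h2 -ler_pdivrMl// h1.
Qed.

Theorem theorem1p4 (R : realType) (d m n s : nat) (hd : (0 < d)%N)
    (rho : 'I_m -> R) (tau : 'I_n -> R)
    (hrho : contraction_vector d rho) (htau : contraction_vector d tau)
    (hequiv : dust_like_equiv d rho tau)
    (lambda : 'I_s -> R)
    (hlrho : pseudo_basis rho lambda) (hltau : pseudo_basis tau lambda) :
  let X := fun j : 'I_m => mlog lambda (rho j) in
  let Y := fun k : 'I_n => mlog lambda (tau k) in
  cone X = cone Y :> set 'rV[R]_s /\
  (forall theta : 'rV[R]_s, enorm theta = 1 -> cone X theta ->
     growth X theta = growth Y theta).
Proof.
move=> X Y.
have [J [T [code [B [JB Jinj]]]]] :=
  lattice_coding hrho htau hequiv hlrho hltau.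
have [J' [T' [code' [B' [JB' Jinj']]]]] :=
  lattice_coding htau hrho (dust_like_equiv_sym hequiv) hltau hlrho.
have cXY : cone X = cone Y :> set 'rV[R]_s.
  by apply/seteqP; split; [exact: (cone_sub JB)|exact: (cone_sub JB')].
split => // theta th1 thX; have thY : cone Y theta by rewrite -cXY.
have [CX lX] := linear_length_mlog hrho.1 hlrho.
have [CY lY] := linear_length_mlog htau.1 hltau.
have [K [E hK]] := mult_compare JB Jinj lX lY th1 thX thY.
have [K' [E' hK']] := mult_compare JB' Jinj' lY lX th1 thY thX.
apply: growth_eq hK hK' => k; first exact: mult_gt0 lX thX.
exact: mult_gt0 lY thY.
Qed.
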